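(* Sabotage game logic $\mathsf{GL_s}$, right-linear game logic $\mathsf{rlGL}$ and the modal $\mu$-calculus $\mathsf{L}_\mu$ are equiexpressive: for any two of these logics, every (closed) formula of the one has a (closed) formula of the other which is equivalent to it in every monotone neighbourhood structure, where a $\mathsf{GL_s}$ formula $\varphi$ and a formula $\psi$ of $\mathsf{rlGL}$ or $\mathsf{L}_\mu$ are equivalent in $\mathcal N$ iff $\{\omega:(\omega,c_0)\in[\![\varphi]\!]\}=[\![\psi]\!]$, and an $\mathsf{rlGL}$ and an $\mathsf{L}_\mu$ formula are equivalent iff their truth sets coincide.
   Context: A monotone neighbourhood structure is $\mathcal N=(W,V,E)$ with $V:\mathbb A\to\mathcal P(W)$ and monotone $E(a):\mathcal P(W)\to\mathcal P(W)$ for atomic games $a\in\mathbb G$; $w^d(A)=W\setminus w(W\setminus A)$. $\mathsf{GL_s}$: formulas $\varphi::=P\mid\neg\varphi\mid\varphi\lor\varphi\mid\langle\alpha\rangle\varphi$; games $\alpha::=a\mid\mathsf{trap}(a)\mid?\varphi\mid\alpha\cup\alpha\mid\alpha;\alpha\mid\alpha^*\mid\alpha^d$. Contexts $c:\mathbb G\to\{\mathsf 0,\mathsf A,\mathsf D\}$ of finite support, set $\mathcal C$, $c_0\equiv\mathsf 0$, $\bar c$ swaps $\mathsf A,\mathsf D$; $U|_c=\{\omega:(\omega,c)\in U\}$, $U^\circ=\{(\omega,c):(\omega,\bar c)\notin U\}$, $w^\circ(U)=(w(U^\circ))^\circ$. Semantics in $W\times\mathcal C$: $[\![P]\!]=V(P)\times\mathcal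 C$, $[\![\neg\varphi]\!]=[\![\varphi]\!]^\circ$, $\lor$ union, $[\![\langle\alpha\rangle\varphi]\!]=[\![\alpha]\!]([\![\varphi]\!])$; $(\omega,c)\in[\![a]\!](U)$ iff ($c(a)=\mathsf 0$ and $\omega\in E(a)(U|_c)$) or ($c(a)=\mathsf A$ and $(\omega,c)\in U$); $[\![\mathsf{trap}(a)]\!](U)=\{(\omega,c):(\omega,c[a\mapsto\mathsf A])\in U\}$; $[\![?\varphi]\!](U)=[\![\varphi]\!]\cap U$; $\cup$ pointwise; $;$ composition; $[\![\alpha^*]\!](U)=\mu B.(U\cup[\![\alpha]\!](B))$; $[\![\alpha^d]\!]=[\![\alpha]\!]^\circ$. $\mathsf{rlGL}$ (normal form): formulas $\varphi::=P\mid\neg P\mid\varphi\lor\varphi\mid\varphi\land\varphi\mid\langle\alpha\rangle\varphi$; games $a\mid a^d\mid x\mid x^d\mid?\varphi\mid?^d\varphi\mid\cup\mid\cap\mid;\mid\mu x.\alpha\mid\nu x.\alpha$ (no variable free in tests, bound variables not under ${}^d$), with no subgame $\beta;\gamma$ having a free variable in $\beta$; semantics under valuations $I$ of variables by monotone maps: $E(a)$, $E(a)^d$, $I(x)$, $I(x)^d$, $[\![?\varphi]\!](A)=[\![\varphi]\!]\cap A$, $[\![?^d\varphi]\!](A)=(W\setminus[\![\varphi]\!])\cup A$, pointwise $\cup,\cap$, composition, and least/greatest fixpoints in the pointwise order on monotone maps of $u\mapsto[\![\alpha]\!]_{I[x\mapsto u]}$; formulas denote subsets via $[\![\langle\alpha\rangle\varphi]\!]=[\![\alpha]\!]([\![\varphi]\!])$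 etc. $\mathsf{L}_\mu$: $\varphi::=P\mid\neg P\mid x\mid\varphi\lor\varphi\mid\varphi\land\varphi\mid\langle a\rangle\varphi\mid[a]\varphi\mid\mu x.\varphi\mid\nu x.\varphi$ with $[\![\langle a\rangle\varphi]\!]=E(a)([\![\varphi]\!])$, $[\![[a]\varphi]\!]=E(a)^d([\![\varphi]\!])$ and fixpoints on $\mathcal P(W)$.
   Formalization: The sets of atomic games and of variables are assumed infinite and the set of atomic propositions nonempty; the statement does not say so and fails otherwise (with no propositions, μx.x has no GL_s equivalent; with one atomic game, GL_s reduces to game logic). *)

(* Defs.v *)
From HB Require Import structures.
From mathcomp Require Import all_boot finmap.
From mathcomp Require Import boolp classical_sets cardinality.

Set Implicit Arguments.
Unset Strict Implicit.
Unset Printing Implicit Defensive.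

Local Open Scope classical_set_scope.

Record monomap (W : Type) := MonoMap {
  mono_fun :> set W -> set W;
  mono_homo : forall B C : set W, B `<=` C -> mono_fun B `<=` mono_fun C }.

(* The carrier is not required to be nonempty. *)
Record nbhd_structure (A G : Type) := NbhdStructure {
  world : Type;
  val_prop : A -> set world;
  eff : G -> monomap world }.

Arguments val_prop {A G} _ _.
Arguments eff {A G} _ _.

Definition dual_map (W : Type) (w : set W -> set W) : set W -> set W :=
  fun B => ~` w (~` B).

(* Least and greatest fixpoints are given by the Knaster-Tarski formula: the
   meet of the prefixpoints and the join of the postfixpoints. *)
Definition lfp (T : Type) (F : set T -> set T) : set T :=
  \bigcap_(B in [set B | F B `<=` B]) B.

Definition gfp (T : Type) (F : set T -> set T) : set T :=
  \bigcup_(B in [set B | B `<=` F B]) B.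

(* The same in the complete lattice of monotone maps on [set W], ordered
   pointwise; meets and joins there are pointwise. *)
Definition lfp_map (W : Type) (F : monomap W -> set W -> set W) :
    set W -> set W :=
  fun B => \bigcap_(u in [set u : monomap W | forall C, F u C `<=` u C]) u B.

Definition gfp_map (W : Type) (F : monomap W -> set W -> set W) :
    set W -> set W :=
  fun B => \bigcup_(u in [set u : monomap W | forall C, u C `<=` F u C]) u B.

Section FixpointFacts.
Variable T : Type.

Lemma lfp_least (F : set T -> set T) (B : set T) : F B `<=` B -> lfp F `<=` B.
Proof. by move=> FB x; apply. Qed.

Lemma lfp_fix (F : set T -> set T) :
  (forall B C, B `<=` C -> F B `<=` F C) -> F (lfp F) = lfp F.
Proof.
move=> Fm; have pre : F (lfp F) `<=` lfp F.
  move=> x Fx B FB; apply/FB.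
  by move: x Fx; apply: Fm; apply: lfp_least.
by apply/seteqP; split=> //; apply: lfp_least; apply: Fm.
Qed.

Lemma gfp_greatest (F : set T -> set T) (B : set T) :
  B `<=` F B -> B `<=` gfp F.
Proof. by move=> FB x Bx; exists B. Qed.

Lemma gfp_fix (F : set T -> set T) :
  (forall B C, B `<=` C -> F B `<=` F C) -> F (gfp F) = gfp F.
Proof.
move=> Fm; have post : gfp F `<=` F (gfp F).
  by move=> x [B FB Bx]; apply: (Fm _ _ (gfp_greatest FB)); apply: FB.
by apply/seteqP; split=> //; apply: gfp_greatest; apply: Fm.
Qed.

Lemma lfp_map_homo (F : monomap T -> set T -> set T) (B C : set T) :
  B `<=` C -> lfp_map F B `<=` lfp_map F C.
Proof. by move=> BC x xB u Fu; apply: (mono_homo BC); apply: xB. Qed.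

Lemma gfp_map_homo (F : monomap T -> set T -> set T) (B C : set T) :
  B `<=` C -> gfp_map F B `<=` gfp_map F C.
Proof. by move=> BC x [u Fu xB]; exists u => //; apply: (mono_homo BC). Qed.

Lemma lfp_map_least (F : monomap T -> set T -> set T) (u : monomap T) :
  (forall C, F u C `<=` u C) -> forall B, lfp_map F B `<=` u B.
Proof. by move=> Fu B x; apply. Qed.

Lemma gfp_map_greatest (F : monomap T -> set T -> set T) (u : monomap T) :
  (forall C, u C `<=` F u C) -> forall B, u B `<=` gfp_map F B.
Proof. by move=> Fu B x; exists u. Qed.

Variable F : monomap T -> set T -> set T.
Hypothesis F_homo : forall u B C, B `<=` C -> F u B `<=` F u C.
Hypothesis F_mono : forall u v : monomap T,
  (forall B, u B `<=` v B) -> forall B, F u B `<=` F v B.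

Lemma lfp_map_fix B :
  F (MonoMap (@lfp_map_homo F)) B = lfp_map F B.
Proof.
have pre C : F (MonoMap (@lfp_map_homo F)) C `<=` lfp_map F C.
  move=> x Fx u Fu; apply/Fu.
  by move: Fx; apply: F_mono => D; apply: lfp_map_least.
apply/seteqP; split=> //.
apply: (@lfp_map_least _ (MonoMap (@F_homo (MonoMap (@lfp_map_homo F))))).
by move=> C /=; apply: F_mono.
Qed.

Lemma gfp_map_fix B :
  F (MonoMap (@gfp_map_homo F)) B = gfp_map F B.
Proof.
have post C : gfp_map F C `<=` F (MonoMap (@gfp_map_homo F)) C.
  move=> x [u Fu ux].
  by apply: (F_mono (u := u)) (Fu _ _ ux) => D; apply: gfp_map_greatest.
apply/seteqP; split=> //.
apply: (@gfp_map_greatest _ (MonoMap (@F_homo (MonoMap (@gfp_map_homo F))))).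
by move=> C /=; apply: F_mono.
Qed.

End FixpointFacts.

Definition upd (X : eqType) (S : Type) (I : X -> S) (x : X) (u : S) : X -> S :=
  fun y => if y == x then u else I y.

Section SabotageGameLogic.
Variables (A : Type) (G : choiceType).

Inductive gls_form :=
  | GsProp of A
  | GsNeg of gls_form
  | GsOr of gls_form & gls_form
  | GsDia of gls_game & gls_form
with gls_game :=
  | GsAtom of G
  | GsTrap of G
  | GsTest of gls_form
  | GsCup of gls_game & gls_game
  | GsSeq of gls_game & gls_game
  | GsStar of gls_game
  | GsDual of gls_game.

End SabotageGameLogic.

(* [Unset] is 0, [AngelTrap] is A and [DemonTrap] is D. *)
Inductive mark := Unset | AngelTrap | DemonTrap.

Lemma mark_comparable : comparable mark.
Proof. by move=> x y; rewrite /decidable; decide equality. Qed.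

HB.instance Definition _ := hasDecEq.Build mark (compareP mark_comparable).

Definition swap_mark (m : mark) : mark :=
  match m with
  | Unset => Unset
  | AngelTrap => DemonTrap
  | DemonTrap => AngelTrap
  end.

Definition context (G : choiceType) := {fsfun G -> mark with Unset}.

Section ContextSemantics.
Variables (G : choiceType) (W : Type).
Implicit Types (c : context G) (U : set (W * context G)).

Definition ctx0 : context G := [fsfun with Unset].

Definition ctx_swap c : context G :=
  [fsfun a in finsupp c => swap_mark (c a) | Unset].

Definition ctx_trap c (a : G) : context G := [fsfun c with a |-> AngelTrap].

Lemma ctx_swapE c a : ctx_swap c a = swap_mark (c a).
Proof. by rewrite fsfun_fun; case: finsuppP. Qed.

Lemma ctx_trapE c a b : ctx_trap c a b = if b == a then AngelTrap else c b.
Proof. exact: fsfun_withE. Qed.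

Definition slice U c : set W := [set w | U (w, c)].

Definition circ U : set (W * context G) :=
  [set p | ~ U (p.1, ctx_swap p.2)].

Definition circ_map (w : set (W * context G) -> set (W * context G)) :=
  fun U => circ (w (circ U)).

End ContextSemantics.

Section SabotageSemantics.
Variables (A : Type) (G : choiceType) (N : nbhd_structure A G).

Fixpoint gls_sem (phi : gls_form A G) : set (world N * context G) :=
  match phi with
  | GsProp P => [set p | val_prop N P p.1]
  | GsNeg phi => circ (gls_sem phi)
  | GsOr phi psi => gls_sem phi `|` gls_sem psi
  | GsDia al phi => gls_gsem al (gls_sem phi)
  end
with gls_gsem (al : gls_game A G) (U : set (world N * context G)) :
    set (world N * context G) :=
  match al with
  | GsAtom a => [set p : world N * context G |
                 (p.2 a = Unset /\ eff N a (slice U p.2) p.1) \/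
                 (p.2 a = AngelTrap /\ U p)]
  | GsTrap a => [set p | U (p.1, ctx_trap p.2 a)]
  | GsTest phi => gls_sem phi `&` U
  | GsCup al be => gls_gsem al U `|` gls_gsem be U
  | GsSeq al be => gls_gsem al (gls_gsem be U)
  | GsStar al => lfp (fun B => U `|` gls_gsem al B)
  | GsDual al => circ_map (gls_gsem al) U
  end.

End SabotageSemantics.

Arguments gls_sem {A G} N phi _.
Arguments gls_gsem {A G} N al U _.

Section RightLinearGameLogic.
Variables (A : Type) (G : Type) (X : eqType).

Inductive rl_form :=
  | RProp of A
  | RNProp of A
  | ROr of rl_form & rl_form
  | RAnd of rl_form & rl_form
  | RDia of rl_game & rl_form
with rl_game :=
  | RAtom of G
  | RDAtom of G
  | RVar of X
  | RDVar of X
  | RTest of rl_form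
  | RDTest of rl_form
  | RCup of rl_game & rl_game
  | RCap of rl_game & rl_game
  | RSeq of rl_game & rl_game
  | RMu of X & rl_game
  | RNu of X & rl_game.

Fixpoint rl_fv (phi : rl_form) : seq X :=
  match phi with
  | RProp _ | RNProp _ => [::]
  | ROr phi psi | RAnd phi psi => rl_fv phi ++ rl_fv psi
  | RDia al phi => rl_gfv al ++ rl_fv phi
  end
with rl_gfv (al : rl_game) : seq X :=
  match al with
  | RAtom _ | RDAtom _ => [::]
  | RVar x | RDVar x => [:: x]
  | RTest phi | RDTest phi => rl_fv phi
  | RCup al be | RCap al be | RSeq al be => rl_gfv al ++ rl_gfv be
  | RMu x al | RNu x al => [seq y <- rl_gfv al | y != x]
  end.

(* Variables with a free occurrence under the dual, that is as [RDVar]. *)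
Fixpoint rl_dfv (phi : rl_form) : seq X :=
  match phi with
  | RProp _ | RNProp _ => [::]
  | ROr phi psi | RAnd phi psi => rl_dfv phi ++ rl_dfv psi
  | RDia al phi => rl_gdfv al ++ rl_dfv phi
  end
with rl_gdfv (al : rl_game) : seq X :=
  match al with
  | RAtom _ | RDAtom _ | RVar _ => [::]
  | RDVar x => [:: x]
  | RTest phi | RDTest phi => rl_dfv phi
  | RCup al be | RCap al be | RSeq al be => rl_gdfv al ++ rl_gdfv be
  | RMu x al | RNu x al => [seq y <- rl_gdfv al | y != x]
  end.

(* The side conditions on the syntax: tests are closed, bound variables do not
   occur dualized, and (right-linearity) the first component of a sequential
   composition is closed. *)
Fixpoint rl_wf (phi : rl_form) : bool :=
  match phi with
  | RProp _ | RNProp _ => true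
  | ROr phi psi | RAnd phi psi => rl_wf phi && rl_wf psi
  | RDia al phi => rl_gwf al && rl_wf phi
  end
with rl_gwf (al : rl_game) : bool :=
  match al with
  | RAtom _ | RDAtom _ | RVar _ | RDVar _ => true
  | RTest phi | RDTest phi => rl_wf phi && nilp (rl_fv phi)
  | RCup al be | RCap al be => rl_gwf al && rl_gwf be
  | RSeq al be => [&& rl_gwf al, rl_gwf be & nilp (rl_gfv al)]
  | RMu x al | RNu x al => rl_gwf al && (x \notin rl_gdfv al)
  end.

Definition rl_closed (phi : rl_form) : bool := nilp (rl_fv phi).

Variable N : nbhd_structure A G.

Fixpoint rl_sem (I : X -> monomap (world N)) (phi : rl_form) : set (world N) :=
  match phi with
  | RProp P => val_prop N P
  | RNProp P => ~` val_prop N P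
  | ROr phi psi => rl_sem I phi `|` rl_sem I psi
  | RAnd phi psi => rl_sem I phi `&` rl_sem I psi
  | RDia al phi => rl_gsem I al (rl_sem I phi)
  end
with rl_gsem (I : X -> monomap (world N)) (al : rl_game) (B : set (world N)) :
    set (world N) :=
  match al with
  | RAtom a => eff N a B
  | RDAtom a => dual_map (eff N a) B
  | RVar x => I x B
  | RDVar x => dual_map (I x) B
  | RTest phi => rl_sem I phi `&` B
  | RDTest phi => ~` rl_sem I phi `|` B
  | RCup al be => rl_gsem I al B `|` rl_gsem I be B
  | RCap al be => rl_gsem I al B `&` rl_gsem I be B
  | RSeq al be => rl_gsem I al (rl_gsem I be B)
  | RMu x al => lfp_map (fun u => rl_gsem (upd I x u) al) B
  | RNu x al => gfp_map (fun u => rl_gsem (upd I x u) al) B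
  end.

End RightLinearGameLogic.

Section ModalMuCalculus.
Variables (A : Type) (G : Type) (X : eqType).

Inductive mu_form :=
  | MProp of A
  | MNProp of A
  | MVar of X
  | MOr of mu_form & mu_form
  | MAnd of mu_form & mu_form
  | MDia of G & mu_form
  | MBox of G & mu_form
  | MMu of X & mu_form
  | MNu of X & mu_form.

Fixpoint mu_fv (phi : mu_form) : seq X :=
  match phi with
  | MProp _ | MNProp _ => [::]
  | MVar x => [:: x]
  | MOr phi psi | MAnd phi psi => mu_fv phi ++ mu_fv psi
  | MDia _ phi | MBox _ phi => mu_fv phi
  | MMu x phi | MNu x phi => [seq y <- mu_fv phi | y != x]
  end.

Definition mu_closed (phi : mu_form) : bool := nilp (mu_fv phi).

Variable N : nbhd_structure A G.

Fixpoint mu_sem (I : X -> set (world N)) (phi : mu_form) : set (world N) :=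
  match phi with
  | MProp P => val_prop N P
  | MNProp P => ~` val_prop N P
  | MVar x => I x
  | MOr phi psi => mu_sem I phi `|` mu_sem I psi
  | MAnd phi psi => mu_sem I phi `&` mu_sem I psi
  | MDia a phi => eff N a (mu_sem I phi)
  | MBox a phi => dual_map (eff N a) (mu_sem I phi)
  | MMu x phi => lfp (fun B => mu_sem (upd I x B) phi)
  | MNu x phi => gfp (fun B => mu_sem (upd I x B) phi)
  end.

End ModalMuCalculus.

(* The truth set of a closed formula does not depend on the valuation of the
   variables; the equivalences are required under every valuation. *)
Section Equivalence.
Variables (A : Type) (G : choiceType) (X : eqType) (N : nbhd_structure A G).

Definition gls_truth (phi : gls_form A G) : set (world N) :=
  [set w | gls_sem N phi (w, ctx0 G)].

Definition gls_rl_equiv (phi : gls_form A G) (psi : rl_form A G X) : Prop :=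
  forall I : X -> monomap (world N), gls_truth phi = rl_sem I psi.

Definition gls_mu_equiv (phi : gls_form A G) (psi : mu_form A G X) : Prop :=
  forall J : X -> set (world N), gls_truth phi = mu_sem J psi.

Definition rl_mu_equiv (phi : rl_form A G X) (psi : mu_form A G X) : Prop :=
  forall (I : X -> monomap (world N)) (J : X -> set (world N)),
    rl_sem I phi = mu_sem J psi.

End Equivalence.

(* Main.v *)
(* All translations pass through the mu-calculus. Operators denoted by
   mu-calculus formulas are closed under finite systems of fixpoint equations
   (Bekic's principle), so a sabotage game can be unfolded into one component
   per context over the finitely many atoms it traps. A right-linear game
   evaluates every free variable at the very set it is applied to, which turns
   fixpoints of monotone maps into pointwise fixpoints of sets, and back.
   Conversely, sabotage provides a finite memory: each mu-calculus variable gets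
   a flag made of two fresh atoms; an occurrence of the variable raises its flag
   and stops, and a loop around the body of its binder replays the body while
   the flag is up. *)

Require Import Defs.
From mathcomp Require Import all_boot finmap.
From mathcomp Require Import boolp classical_sets functions cardinality.

Set Implicit Arguments.
Unset Strict Implicit.
Unset Printing Implicit Defensive.

Local Open Scope classical_set_scope.

(* Definability is a property of operators over an arbitrary type of variables, so that
   substitution, duality and the elimination of equations involve no capture of names; names are
   chosen once, at the end. A sabotage star is a fixpoint over infinitely many contexts. It can be
   cut down to a finite system because a play that starts in a context supported by the trapped
   atoms never leaves such contexts, and the dual, which swaps marks, keeps the support. In the flag
   encoding the winning set itself serves as the valuation: the value of [y] is its slice at the
   context where only the flag of [y] is up. The invariant is that every subformula starts with all
   flags down, and that each play of it is either decided or ends with exactly one flag up. *)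
Scheme gls_form_mut := Induction for gls_form Sort Prop
  with gls_game_mut := Induction for gls_game Sort Prop.
Combined Scheme gls_mutind from gls_form_mut, gls_game_mut.

Scheme rl_form_mut := Induction for rl_form Sort Prop
  with rl_game_mut := Induction for rl_game Sort Prop.
Combined Scheme rl_mutind from rl_form_mut, rl_game_mut.

Lemma infinite_set_inj (T : Type) (B : set T) : infinite_set B ->
  exists2 f : nat -> T, injective f & forall n, B (f n).
Proof.
move=> /infiniteP/card_leP[f].
exists (fun n => \val (f (SigSub (mem_set (I : [set: nat] n))))) => [m n|n].
  by move=> /val_inj /(@inj _ _ _ f) H; have [] := H (mem_setT _) (mem_setT _).
exact: set_valP.
Qed.

Lemma subset_cat (T : eqType) (s t : seq T) (P : {pred T}) :
  {subset s ++ t <= P} -> {subset s <= P} /\ {subset t <= P}.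
Proof.
by move=> H; split=> x xs; apply: H; rewrite mem_cat xs ?orbT.
Qed.

(** * Fixpoints *)

Section Fixpoints.
Variable T : Type.
Implicit Types F : set T -> set T.

Lemma eq_lfp F F' : F =1 F' -> lfp F = lfp F'.
Proof. by move=> /funext ->. Qed.

Lemma eq_gfp F F' : F =1 F' -> gfp F = gfp F'.
Proof. by move=> /funext ->. Qed.

Lemma lfp_homo F F' : (forall B, F B `<=` F' B) -> lfp F `<=` lfp F'.
Proof. by move=> FF x xF B FB; apply: xF => y /FF /FB. Qed.

Lemma gfp_homo F F' : (forall B, F B `<=` F' B) -> gfp F `<=` gfp F'.
Proof. by move=> FF x [B FB Bx]; exists B => // y /FB /FF. Qed.

Lemma setC_lfp F : ~` lfp F = gfp (fun B => ~` F (~` B)).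
Proof.
apply/seteqP; split=> x.
  move=> /existsNP[B /not_implyP[FB nBx]]; exists (~` B) => //= y nBy.
  by rewrite setCK => /FB.
move=> [B BF Bx] /(_ (~` B)); apply => // y Fy By.
exact: BF By Fy.
Qed.

Lemma setC_gfp F : ~` gfp F = lfp (fun B => ~` F (~` B)).
Proof.
rewrite -[RHS]setCK setC_lfp; congr (~` _).
by apply: eq_gfp => B; rewrite !setCK.
Qed.

Variables (F : monomap T -> set T -> set T) (Phi : set T -> set T -> set T).
Hypothesis F_pointwise : forall u C, F u C = Phi C (u C).
Hypothesis Phi_homo : forall C C' Y Y',
  C `<=` C' -> Y `<=` Y' -> Phi C Y `<=` Phi C' Y'.

(** The pointwise fixpoints form a monotone map, which is one of the prefixpoints [u]; conversely
    the value at [B] of any prefixpoint [u] is a prefixpoint of [Phi B]. *)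
Lemma lfp_map_pointwise B : lfp_map F B = lfp (Phi B).
Proof.
have Lm C C' : C `<=` C' -> lfp (Phi C) `<=` lfp (Phi C').
  by move=> CC; apply: lfp_homo => Y; apply: Phi_homo.
apply/seteqP; split.
  apply: (@lfp_map_least _ _ (MonoMap Lm)) => C; rewrite F_pointwise /=.
  by rewrite lfp_fix // => Y Y'; apply: Phi_homo.
by move=> x Lx u Fu; apply: Lx => /=; rewrite -F_pointwise; apply: Fu.
Qed.

Lemma gfp_map_pointwise B : gfp_map F B = gfp (Phi B).
Proof.
have Lm C C' : C `<=` C' -> gfp (Phi C) `<=` gfp (Phi C').
  by move=> CC; apply: gfp_homo => Y; apply: Phi_homo.
apply/seteqP; split.
  by move=> x [u Fu ux]; exists (u B) => //=; rewrite -F_pointwise; apply: Fu.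
apply: (@gfp_map_greatest _ _ (MonoMap Lm)) => C; rewrite F_pointwise /=.
by rewrite gfp_fix // => Y Y'; apply: Phi_homo.
Qed.

End Fixpoints.

(** * The semantic counterpart of the mu-calculus *)

Section Definable.
Variables (A : Type) (G : choiceType).

Definition operator (V : Type) :=
  forall N : nbhd_structure A G, (V -> set (world N)) -> set (world N).

(* The operators denoted by mu-calculus formulas with free variables in [V].
   A fixpoint binds the variable [None] of [option V]. *)
Inductive definable : forall V : Type, operator V -> Prop :=
  | def_prop V P : @definable V (fun N _ => val_prop N P)
  | def_nprop V P : @definable V (fun N _ => ~` val_prop N P)
  | def_var V v : @definable V (fun N J => J v)
  | def_or V F H : @definable V F -> @definable V H ->
      @definable V (fun N J => F N J `|` H N J)
  | def_and V F H : @definable V F -> @definable V H ->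
      @definable V (fun N J => F N J `&` H N J)
  | def_dia V a F : @definable V F ->
      @definable V (fun N J => eff N a (F N J))
  | def_box V a F : @definable V F ->
      @definable V (fun N J => dual_map (eff N a) (F N J))
  | def_mu V F : @definable (option V) F ->
      @definable V (fun N J => lfp (fun B => F N (oapp J B)))
  | def_nu V F : @definable (option V) F ->
      @definable V (fun N J => gfp (fun B => F N (oapp J B))).

Lemma eq_definable V (F H : operator V) :
  (forall N J, F N J = H N J) -> definable F -> definable H.
Proof.
move=> FH; suff -> : F = H by [].
by apply: functional_extensionality_dep => N; apply: funext => J.
Qed.

Lemma definable_homo V (F : operator V) : definable F ->
  forall N (J J' : V -> set (world N)),
  (forall v, J v `<=` J' v) -> F N J `<=` F N J'.
Proof.
move=> dF N; elim: V F / dF => /=.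
- by move=> V P J J' _.
- by move=> V P J J' _.
- by move=> V v J J'; apply.
- by move=> V F H _ IF _ IH J J' JJ; apply: setUSS; [apply: IF|apply: IH].
- by move=> V F H _ IF _ IH J J' JJ; apply: setISS; [apply: IF|apply: IH].
- by move=> V a F _ IF J J' JJ; apply: mono_homo; apply: IF.
- move=> V a F _ IF J J' JJ; apply: subsetC; apply: mono_homo.
  by apply: subsetC; apply: IF.
- by move=> V F _ IF J J' JJ; apply: lfp_homo => B; apply: IF => -[].
- by move=> V F _ IF J J' JJ; apply: gfp_homo => B; apply: IF => -[].
Qed.

Lemma definable_rename V (F : operator V) : definable F ->
  forall V' (r : V -> V'), definable (fun N J => F N (J \o r)).
Proof.
move=> dF; elim: V F / dF => /=.
- by move=> V P V' r; apply: def_prop.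
- by move=> V P V' r; apply: def_nprop.
- by move=> V v V' r; apply: def_var.
- by move=> V F H _ IF _ IH V' r; apply: def_or.
- by move=> V F H _ IF _ IH V' r; apply: def_and.
- by move=> V a F _ IF V' r; apply: def_dia.
- by move=> V a F _ IF V' r; apply: def_box.
- move=> V F _ IF V' r; apply: eq_definable (def_mu (IF _ (omap r))) => N J.
  by apply: eq_lfp => B; congr (F N _); apply: funext => -[].
- move=> V F _ IF V' r; apply: eq_definable (def_nu (IF _ (omap r))) => N J.
  by apply: eq_gfp => B; congr (F N _); apply: funext => -[].
Qed.

Lemma definable_subst V (F : operator V) : definable F ->
  forall V' (f : V -> operator V'), (forall v, definable (f v)) ->
  definable (fun N J => F N (fun v => f v N J)).
Proof.
(* Under a binder the bound variable [None] stays itself, and the substituted operators are weakened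
   along [Some]. *)
have lift V1 V' (f : V1 -> operator V') : (forall v, definable (f v)) ->
    forall o, definable (fun N J =>
      oapp (fun v => f v N (J \o Some)) (J None) o).
  by move=> df [v|] /=; [apply: definable_rename|apply: def_var].
move=> dF; elim: V F / dF => /=.
- by move=> V P V' r dr; apply: def_prop.
- by move=> V P V' r dr; apply: def_nprop.
- by move=> V v V' r; apply.
- by move=> V F H _ IF _ IH V' r dr; apply: def_or; [apply: IF|apply: IH].
- by move=> V F H _ IF _ IH V' r dr; apply: def_and; [apply: IF|apply: IH].
- by move=> V a F _ IF V' r dr; apply: def_dia; apply: IF.
- by move=> V a F _ IF V' r dr; apply: def_box; apply: IF.
- move=> V F _ IF V' f /lift df.
  apply: eq_definable (def_mu (IF _ _ df)) => N J.
  by apply: eq_lfp => B; congr (F N _); apply: funext => -[].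
- move=> V F _ IF V' f /lift df.
  apply: eq_definable (def_nu (IF _ _ df)) => N J.
  by apply: eq_gfp => B; congr (F N _); apply: funext => -[].
Qed.

(** Negation is available only on proposition letters; complementing the arguments along with the
    result leaves every variable positive, so each constructor is exchanged with its De Morgan
    dual. *)
Lemma definable_dual V (F : operator V) : definable F ->
  definable (fun N J => ~` F N (fun v => ~` J v)).
Proof.
move=> dF; elim: V F / dF => /=.
- by move=> V P; apply: def_nprop.
- by move=> V P; apply: eq_definable (def_prop _ P) => N J; rewrite setCK.
- by move=> V v; apply: eq_definable (def_var v) => N J; rewrite setCK.
- move=> V F H _ IF _ IH; apply: eq_definable (def_and IF IH) => N J.
  by rewrite setCU.
- move=> V F H _ IF _ IH; apply: eq_definable (def_or IF IH) => N J.
  by rewrite setCI.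
- move=> V a F _ IF; apply: eq_definable (def_box a IF) => N J.
  by rewrite /dual_map setCK.
- move=> V a F _ IF; apply: eq_definable (def_dia a IF) => N J.
  by rewrite /dual_map setCK.
- move=> V F _ IF; apply: eq_definable (def_nu IF) => N J.
  rewrite setC_lfp; apply: eq_gfp => B; congr (~` F N _).
  by apply: funext => -[].
- move=> V F _ IF; apply: eq_definable (def_mu IF) => N J.
  rewrite setC_gfp; apply: eq_lfp => B; congr (~` F N _).
  by apply: funext => -[].
Qed.

(** Falsity as [mu x. x]. *)
Lemma definable_set0 V : @definable V (fun N _ => set0).
Proof.
apply: eq_definable (def_mu (def_var None)) => N J /=.
by apply/seteqP; split=> // x /(_ set0); apply.
Qed.

(* The variable bound at depth [n] is named [h n]. *)
Lemma definable_mu_form (X : eqType) (h : nat -> X) : injective h ->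
  forall V (F : operator V), definable F ->
  forall n (f : V -> nat), (forall v, f v < n)%N ->
  exists2 phi : mu_form A G X,
    {in mu_fv phi, forall x, exists v, x = h (f v)} &
    forall N (J : X -> set (world N)),
      mu_sem J phi = F N (fun v => J (h (f v))).
Proof.
move=> hI V F dF.
have bind V1 n (f : V1 -> nat) : (forall v, f v < n)%N ->
    forall o, (oapp f n o < n.+1)%N.
  by move=> fn [v|] //=; apply: ltnW; apply: fn.
have fvB V1 n (f : V1 -> nat) (s : seq X) :
    {in s, forall x, exists o, x = h (oapp f n o)} ->
    {in [seq y <- s | y != h n], forall x, exists v, x = h (f v)}.
  move=> sP x; rewrite mem_filter => /andP[xn /sP[[v|] /= xE]].
    by exists v.
  by rewrite xE eqxx in xn.
(* The name [h n] is fresh: the variables in scope have names of index below [n], and [h] is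
   injective. *)
have updE V1 n (f : V1 -> nat) W (J : X -> set W) B : (forall v, f v < n)%N ->
    (fun o => upd J (h n) B (h (oapp f n o))) = oapp (fun v => J (h (f v))) B.
  move=> fn; apply: funext => -[v|] /=; rewrite /upd ?eqxx //.
  by case: eqP => // /hI e; have := fn v; rewrite e ltnn.
have cat2 V1 (f : V1 -> nat) (s t : seq X) :
    {in s, forall x, exists v, x = h (f v)} ->
    {in t, forall x, exists v, x = h (f v)} ->
    {in s ++ t, forall x, exists v, x = h (f v)}.
  by move=> sP tP x; rewrite mem_cat => /orP[/sP|/tP].
elim: V F / dF => /=.
- by move=> V P n f fn; exists (MProp _ _ P).
- by move=> V P n f fn; exists (MNProp _ _ P).
- move=> V v n f fn; exists (MVar _ _ (h (f v))) => // x.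
  by rewrite inE => /eqP ->; exists v.
- move=> V F H _ IF _ IH n f fn; have [phi p1 p2] := IF n f fn.
  have [psi q1 q2] := IH n f fn; exists (MOr phi psi); first exact: cat2.
  by move=> N J /=; rewrite p2 q2.
- move=> V F H _ IF _ IH n f fn; have [phi p1 p2] := IF n f fn.
  have [psi q1 q2] := IH n f fn; exists (MAnd phi psi); first exact: cat2.
  by move=> N J /=; rewrite p2 q2.
- move=> V a F _ IF n f fn; have [phi p1 p2] := IF n f fn.
  by exists (MDia a phi) => // N J /=; rewrite p2.
- move=> V a F _ IF n f fn; have [phi p1 p2] := IF n f fn.
  by exists (MBox a phi) => // N J /=; rewrite p2.
- move=> V F _ IF n f fn; have [phi p1 p2] := IF n.+1 _ (bind _ _ _ fn).
  exists (MMu (h n) phi); first exact: fvB.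
  by move=> N J /=; apply: eq_lfp => B; rewrite p2 updE.
- move=> V F _ IF n f fn; have [phi p1 p2] := IF n.+1 _ (bind _ _ _ fn).
  exists (MNu (h n) phi); first exact: fvB.
  by move=> N J /=; apply: eq_gfp => B; rewrite p2 updE.
Qed.

Lemma definable_closed (X : eqType) (F : operator void) :
  infinite_set [set: X] -> definable F ->
  exists2 psi : mu_form A G X, mu_closed psi &
    forall N (J : X -> set (world N)), mu_sem J psi = F N (of_void _).
Proof.
move=> /infinite_set_inj[h hI _] dF.
have [psi psi_fv psiE] := definable_mu_form hI dF
  (fun v : void => match v with end : (of_void nat v < 0)%N).
exists psi; first by rewrite /mu_closed; case: mu_fv psi_fv => // x r
  /(_ x (mem_head _ _)) [[]].
by move=> N J; rewrite psiE; congr (F N _); apply: funext => -[].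
Qed.

End Definable.

(** * Systems of fixpoint equations *)

Section Bekic.
Variables (W : Type) (K : eqType).
Implicit Types (B C : set (W * K)) (Y : set W) (t : seq K).

(* The system [Phi] solved for the components in [t], with the other components
   fixed to those of [B]. *)
Definition partial_system (Phi : set (W * K) -> set (W * K)) t B C :
    set (W * K) :=
  [set p | if p.2 \in t then Phi C p else B p].

Definition set_component B (k : K) Y : set (W * K) :=
  [set p | if p.2 == k then Y p.1 else B p].

Variables (Phi : set (W * K) -> set (W * K)) (k0 : K) (t : seq K).
Hypothesis k0t : k0 \notin t.
Hypothesis Phi_homo : forall k, k \in k0 :: t ->
  forall C C', C `<=` C' -> forall w, Phi C (w, k) -> Phi C' (w, k).

Let solve B Y := lfp (partial_system Phi t (set_component B k0 Y)).

(** Bekic's principle: the equations in [t] are solved with component [k0] as a parameter, and the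
    result is fed into the equation of [k0]. The right side is a prefixpoint of the whole system,
    which gives one inclusion. *)
Lemma lfp_system_cons B :
  lfp (partial_system Phi (k0 :: t) B) =
  solve B (lfp (fun Y => [set w | Phi (solve B Y) (w, k0)])).
Proof.
have sys_homo s B' : {subset s <= k0 :: t} ->
    forall C C', C `<=` C' ->
    partial_system Phi s B' C `<=` partial_system Phi s B' C'.
  move=> st C C' CC [w k] /=; rewrite /partial_system /=.
  by case: ifP => // ks; apply: Phi_homo => //; apply: st.
have st : {subset t <= k0 :: t} by move=> k kt; rewrite inE kt orbT.
have solveE Y w k : solve B Y (w, k) =
    if k \in t then Phi (solve B Y) (w, k)
    else if k == k0 then Y w else B (w, k).
  by rewrite {1}/solve -lfp_fix //; apply: sys_homo.
have solve_homo Y Y' : Y `<=` Y' -> solve B Y `<=` solve B Y'.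
  move=> YY; apply: lfp_homo => C [w k].
  rewrite /partial_system /set_component /=.
  by case: ifP => // _; case: ifP => // _; apply: YY.
have g_homo Y Y' : Y `<=` Y' -> [set w | Phi (solve B Y) (w, k0)] `<=`
    [set w | Phi (solve B Y') (w, k0)].
  by move=> YY w; apply: Phi_homo; [exact: mem_head|exact: solve_homo].
set Ys := (X in solve B X).
have YsE : [set w | Phi (solve B Ys) (w, k0)] = Ys by exact: lfp_fix.
set L := lfp _.
have LE w k : L (w, k) = if k \in k0 :: t then Phi L (w, k) else B (w, k).
  by rewrite {1}/L -lfp_fix //; apply: sys_homo.
have k0E : k0 \in k0 :: t by exact: mem_head.
apply/seteqP; split.
  apply: lfp_least => -[w k]; rewrite solveE /partial_system /= inE.
  case: (eqVneq k k0) => [->|//] /=.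
  by rewrite (negPf k0t) -{2}YsE.
(* For the converse, [L] with its component [k0] read as a constant is a prefixpoint of the
   equations in [t], which makes that component a prefixpoint of the outer operator. *)
have solveL : solve B [set w | L (w, k0)] `<=` L.
  apply: lfp_least => -[w k]; rewrite [X in _ -> X]LE.
  rewrite /partial_system /set_component /= inE.
  by case: (eqVneq k k0) => [->|//] /=; rewrite (negPf k0t) LE k0E.
have YsL : Ys `<=` [set w | L (w, k0)].
  by apply: lfp_least => w /= /(Phi_homo k0E solveL); rewrite LE k0E.
exact: subset_trans (solve_homo _ _ YsL) solveL.
Qed.

End Bekic.

Section DefinableSystem.
Variables (A : Type) (G : choiceType) (V : Type) (K : eqType).
Variable F : forall N : nbhd_structure A G, (V -> set (world N)) ->
  set (world N * K) -> set (world N * K).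

Let graph W (E : V + K -> set W) : set (W * K) := [set p | E (inr p.2) p.1].

Variable s : seq K.
Hypothesis F_def : forall k, k \in s ->
  definable (fun N (E : V + K -> set (world N)) =>
    [set w | F (E \o inl) (graph E) (w, k)]).

(** Components that are not yet solved for are kept as additional variables [inr k]; each step of
    the induction eliminates one of them by a single fixpoint. *)
Lemma definable_partial_lfp t : {subset t <= s} -> forall k,
  definable (fun N (E : V + K -> set (world N)) =>
    [set w | lfp (partial_system (F (E \o inl)) t (graph E)) (w, k)]).
Proof.
elim: t => [_ k|k0 t IH sub k].
  apply: eq_definable (def_var _ _ (inr k)) => N E.
  apply/seteqP; split=> w /=.
    by move=> Ew B; apply.
  by move=> /(_ (graph E)); apply=> -[].
have st : {subset t <= s} by move=> k1 kt; apply: sub; rewrite inE kt orbT.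
(* A repeated component changes nothing, since a partial system depends on its list only through
   membership. *)
have [k0t|k0t] := boolP (k0 \in t).
  apply: eq_definable (IH st k) => N E.
  suff -> : partial_system (F (E \o inl)) t =
      partial_system (F (E \o inl)) (k0 :: t) by [].
  apply: funext => B; apply: funext => C; apply: funext => p.
  rewrite /partial_system /mkset in_cons.
  by case: eqP => // ->; rewrite k0t.
pose fill W (E : V + K -> set W) Y : V + K -> set W :=
  fun v => if v is inr k1 then if k1 == k0 then Y else E v else E v.
have graph_fill W (E : V + K -> set W) Y :
    graph (fill W E Y) = set_component (graph E) k0 Y.
  by apply/seteqP; split=> -[w k1]; rewrite /graph /set_component /=; case: ifP.
pose sol (N : nbhd_structure A G) (E : V + K -> set (world N)) Y :=
  lfp (partial_system (F (E \o inl)) t (set_component (graph E) k0 Y)).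
(* The induction hypothesis with the variable [inr k0] turned into the variable [None] that the new
   fixpoint will bind. *)
have sol_def k1 : definable (fun N (E : option (V + K) -> set (world N)) =>
    [set w | sol N (E \o Some) (E None) (w, k1)]).
  pose f (v : V + K) : operator A G (option (V + K)) := fun N E =>
    fill _ (E \o Some) (E None) v.
  have df v : definable (f v).
    by case: v => [v|k2]; rewrite /f /=; [|case: (k2 == k0)]; apply: def_var.
  apply: eq_definable (definable_subst (IH st k1) df) => N E.
  by rewrite -[fun v => f v N E]/(fill _ (E \o Some) (E None)) graph_fill.
pose f (v : V + K) : operator A G (option (V + K)) := fun N E =>
  if v is inr k1 then [set w | sol N (E \o Some) (E None) (w, k1)]
  else E (Some v).
have df v : definable (f v).
  by case: v => [v|k1]; [apply: def_var|apply: sol_def].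
have dY := def_mu (definable_subst (F_def (sub _ (mem_head _ _))) df).
(* Back substitution: the value found for [k0] replaces [None] in the solutions of all
   components. *)
pose f' (o : option (V + K)) : operator A G (V + K) := fun N E =>
  oapp E (lfp (fun Y => [set w | F (E \o inl) (sol N E Y) (w, k0)])) o.
have df' o : definable (f' o).
  case: o => [v|]; first exact: def_var.
  apply: eq_definable dY => N E; apply: eq_lfp => Y.
  have -> : graph (fun v => f v N (oapp E Y)) = sol N E Y.
    by apply/seteqP; split=> -[].
  by [].
apply: eq_definable (definable_subst (sol_def k) df') => N E.
rewrite lfp_system_cons // => k1 k1t C C' CC w.
(* The monotonicity required by Bekic's principle is read off the definability of the equations,
   with [C] passed as the values of the components. *)
pose E' C : V + K -> set (world N) :=
  fun v => match v with inl v => E (inl v) | inr k => [set w | C (w, k)] end.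
have gE C1 : graph (E' C1) = C1 by apply/seteqP; split=> -[].
move: (definable_homo (F_def (sub _ k1t)) (N := N) (J := E' C) (J' := E' C')).
rewrite !gE => H; apply: H => -[v //|k2 w' /=]; exact: CC.
Qed.

Lemma definable_lfp_system k :
  definable (fun N (J : V -> set (world N)) =>
    [set w | lfp (partial_system (F J) s set0) (w, k)]).
Proof.
have H := definable_partial_lfp (t := s) (fun _ => id) k.
pose f (v : V + K) : operator A G V := fun N J =>
  if v is inl v then J v else set0.
have df v : definable (f v).
  by case: v => [v|k1]; [apply: def_var|apply: definable_set0].
apply: eq_definable (definable_subst H df) => N J.
suff -> : graph (fun v => f v N J) = set0 by [].
by apply/seteqP; split=> -[].
Qed.

End DefinableSystem.

(** * From sabotage game logic to the mu-calculus *)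

Section Contexts.
Variables (G : choiceType) (W : Type).
Implicit Types (c : context G) (U : set (W * context G)).

Lemma ctx_swapK : involutive (@ctx_swap G).
Proof. by move=> c; apply/fsfunP => a; rewrite !ctx_swapE; case: (c a). Qed.

Lemma circK : involutive (@circ G W).
Proof.
move=> U; apply/seteqP; split=> -[w c] /=; rewrite /circ /= ctx_swapK.
  by move=> /contrapT.
by move=> Uwc; apply.
Qed.

Lemma circ_homo U U' : U `<=` U' -> circ U' `<=` circ U.
Proof. by move=> UU p nU' /UU. Qed.

Lemma slice_circ U c : slice (circ U) c = ~` slice U (ctx_swap c).
Proof. by []. Qed.

(** Induction on the atoms: a context supported by [a :: r] arises from one supported by [r] by
    choosing one of three marks for [a]. *)
Lemma contexts_supported_finite (S : {fset G}) :
  exists s : seq (context G), forall c, (c \in s) = (finsupp c `<=` S)%fset.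
Proof.
suff [s sP] : exists s : seq (context G),
    forall c, (finsupp c `<=` S)%fset -> c \in s.
  exists [seq c <- s | (finsupp c `<=` S)%fset] => c.
  by rewrite mem_filter andb_idr //; apply: sP.
suff [s sP] : exists s : seq (context G),
    forall c, {subset finsupp c <= enum_fset S} -> c \in s.
  by exists s => c /fsubsetP; apply: sP.
elim: (enum_fset S) => [|a r [s sP]].
  exists [:: ctx0 G] => c c0; rewrite inE; apply/eqP/fsfunP => a.
  rewrite [RHS]fsfun0E; apply/eqP; apply: contraT => ca.
  by have := c0 a; rewrite mem_finsupp => /(_ ca).
exists [seq [fsfun c with a |-> m] | c : context G <- s,
  m <- [:: Unset; AngelTrap; DemonTrap]] => c cS.
apply/allpairsP; exists ([fsfun c with a |-> Unset], c a); split=> /=.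
- apply: sP => b; rewrite mem_finsupp fsfun_withE.
  case: (eqVneq b a) => [_|ba cb]; first by rewrite eqxx.
  have := cS b; rewrite mem_finsupp inE.
  by rewrite (negPf ba) => /(_ cb).
- by case: (c a); rewrite !inE eqxx ?orbT.
- apply/fsfunP => b; rewrite !fsfun_withE.
  by case: (eqVneq b a) => // ->.
Qed.

End Contexts.

Section Traps.
Variables (A : Type) (G : choiceType).

Fixpoint gls_traps (phi : gls_form A G) : seq G :=
  match phi with
  | GsProp _ => [::]
  | GsNeg phi => gls_traps phi
  | GsOr phi psi => gls_traps phi ++ gls_traps psi
  | GsDia al phi => gls_gtraps al ++ gls_traps phi
  end
with gls_gtraps (al : gls_game A G) : seq G :=
  match al with
  | GsAtom _ => [::]
  | GsTrap a => [:: a]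
  | GsTest phi => gls_traps phi
  | GsCup al be | GsSeq al be => gls_gtraps al ++ gls_gtraps be
  | GsStar al | GsDual al => gls_gtraps al
  end.

Section Local.
Variables (N : nbhd_structure A G) (D : pred (context G)) (S : {pred G}).
Hypothesis swapD : forall c, D c -> D (ctx_swap c).
Hypothesis trapD : forall c a, a \in S -> D c -> D (ctx_trap c a).

(** Only traps and duals change the context, and [D] is closed under both. With the trivial [D] this
    is plain monotonicity. *)
Lemma gls_gsem_local (al : gls_game A G) (U U' : set (world N * context G)) :
  {subset gls_gtraps al <= S} ->
  (forall w c, D c -> U (w, c) -> U' (w, c)) ->
  forall w c, D c -> gls_gsem N al U (w, c) -> gls_gsem N al U' (w, c).
Proof.
elim: al U U' => /=.
- move=> a U U' _ UU w c Dc [[ca H]|[ca H]]; [left|right]; split=> //.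
    by apply: mono_homo H => v; apply: UU.
  exact: UU.
- move=> a U U' sS UU w c Dc; apply: UU; apply: trapD => //.
  by apply: sS; rewrite inE.
- by move=> phi U U' _ UU w c Dc [H K]; split=> //; apply: UU.
- move=> al IHa be IHb U U' /subset_cat[sa sb] UU w c Dc [H|H]; [left|right].
    exact: IHa H.
  exact: IHb H.
- move=> al IHa be IHb U U' /subset_cat[sa sb] UU w c Dc.
  by apply: IHa => // v d Dd; apply: IHb.
- move=> al IH U U' sS UU w c Dc H B UB.
  (* The prefixpoint [B] is enlarged by everything outside [D], so that nothing has to be checked
     there. *)
  suff : [set p : world N * context G | D p.2 -> B p] (w, c) by apply.
  apply: H => -[v d] /= [Uvd|H] Dd; first by apply: UB; left; apply: UU.
  apply: UB; right; apply: IH H => // v' d' Dd'; exact.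
- move=> al IH U U' sS UU w c Dc; rewrite /circ_map /circ /= => + H; apply.
  apply: IH H => //; last exact: swapD.
  by move=> v d Dd /= + H; apply; apply: UU => //; apply: swapD.
Qed.

End Local.

Lemma gls_gsem_homo N (al : gls_game A G) U U' :
  U `<=` U' -> gls_gsem N al U `<=` gls_gsem N al U'.
Proof.
move=> UU [w c]; apply: (@gls_gsem_local N predT predT) => // v d _.
exact: UU.
Qed.

Section Translation.
Variable S : {fset G}.

Let D (c : context G) : bool := (finsupp c `<=` S)%fset.

Let swapD c : D c -> D (ctx_swap c).
Proof.
move=> /fsubsetP cS; apply/fsubsetP => a; rewrite mem_finsupp ctx_swapE => ca.
by apply: cS; rewrite mem_finsupp; apply: contraNneq ca => ->.
Qed.

Let trapD c a : a \in S -> D c -> D (ctx_trap c a).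
Proof.
move=> aS /fsubsetP cS; apply/fsubsetP => b; rewrite mem_finsupp ctx_trapE.
by case: (b =P a) => [->//|_ cb]; apply: cS; rewrite mem_finsupp.
Qed.

(** Admitting every family [U] with definable slices lets the star apply its induction hypothesis to
    the tautological family, whose slice at [d] is the variable [inr d] of the system. *)
Lemma gls_slice_definable :
  (forall phi : gls_form A G, {subset gls_traps phi <= S} ->
    forall V c, D c -> @definable A G V (fun N _ => slice (gls_sem N phi) c)) /\
  (forall al : gls_game A G, {subset gls_gtraps al <= S} ->
    forall V (U : forall N, (V -> set (world N)) -> set (world N * context G)),
    (forall c, D c -> @definable A G V (fun N J => slice (U N J) c)) ->
    forall c, D c ->
      @definable A G V (fun N J => slice (gls_gsem N al (U N J)) c)).
Proof.
apply: gls_mutind => /=.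
- by move=> P _ V c _; apply: def_prop.
- move=> phi IH sS V c /swapD Dc.
  exact: definable_dual (IH sS V _ Dc).
- move=> phi IH1 psi IH2 /subset_cat[s1 s2] V c Dc.
  exact: def_or (IH1 s1 V _ Dc) (IH2 s2 V _ Dc).
- move=> al IH1 phi IH2 /subset_cat[s1 s2] V c Dc.
  by apply: (IH1 s1 V (fun N _ => gls_sem N phi)) => // d; apply: IH2.
- move=> a _ V U dU c Dc; case ca: (c a).
  + apply: eq_definable (def_dia a (dU c Dc)) => N J.
    apply/seteqP; split=> w; first by left.
    by case=> -[] /=; rewrite ca.
  + apply: eq_definable (dU c Dc) => N J.
    apply/seteqP; split=> w; first by right.
    by case=> -[] /=; rewrite ca.
  + apply: eq_definable (definable_set0 A G V) => N J.
    by apply/seteqP; split=> w //; case=> -[] /=; rewrite ca.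
- move=> a sS V U dU c Dc; apply: (dU (ctx_trap c a)); apply: trapD => //.
  by apply: sS; rewrite inE.
- move=> phi IH sS V U dU c Dc.
  exact: def_and (IH sS V _ Dc) (dU _ Dc).
- move=> al IH1 be IH2 /subset_cat[s1 s2] V U dU c Dc.
  exact: def_or (IH1 s1 V U dU _ Dc) (IH2 s2 V U dU _ Dc).
- move=> al IH1 be IH2 /subset_cat[s1 s2] V U dU c Dc.
  by apply: (IH1 s1 V (fun N J => gls_gsem N be (U N J))) => // d; apply: IH2.
- move=> al IH sS V U dU c Dc.
  have [s sP] := contexts_supported_finite S.
  pose F N (J : V -> set (world N)) (C : set (world N * context G)) :=
    U N J `|` gls_gsem N al C.
  have F_def k : k \in s ->
      definable (fun N (E : V + context G -> set (world N)) =>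
        [set w | F N (E \o inl) [set p | E (inr p.2) p.1] (w, k)]).
    rewrite sP => Dk.
    apply: def_or (definable_rename (dU k Dk) inl) _.
    apply: (IH sS _ (fun N E => [set p | E (inr p.2) p.1])) => // d _.
    exact: eq_definable (def_var _ _ (inr d)).
  (* The star is a fixpoint over all contexts, whereas the system covers those in [s] and is empty
     elsewhere; by locality the two agree at contexts in [D]. *)
  apply: eq_definable (definable_lfp_system F_def c) => N J.
  have Fm : forall B C, B `<=` C -> F N J B `<=` F N J C.
    by move=> B C BC; apply: setUS; apply: gls_gsem_homo.
  apply/seteqP; split=> w; rewrite /slice /=.
    move: (w, c); apply: lfp_least => p.
    by rewrite /partial_system /=; case: ifP => // _; rewrite (lfp_fix Fm).
  move=> H B sysB.
  suff : [set p : world N * context G | D p.2 -> B p] (w, c) by apply.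
  apply: H => -[v d] /= H Dd; apply: sysB.
  rewrite /partial_system /= sP -/(D d) Dd.
  case: H => [|H]; [by left|right].
  apply: (gls_gsem_local swapD trapD sS _ Dd H) => v' d' Dd'; exact.
- move=> al IH sS V U dU c /swapD Dc.
  (* The valuation is complemented here and once more by the outer [definable_dual], so that [U] is
     finally read at [J] itself. *)
  pose U' N (J : V -> set (world N)) := circ (U N (fun v => ~` J v)).
  have dU' d : D d -> definable (fun N J => slice (U' N J) d).
    by move=> /swapD Dd; apply: definable_dual (dU _ Dd).
  apply: eq_definable (definable_dual (IH sS V U' dU' _ Dc)) => N J.
  rewrite /U' /circ_map slice_circ.
  congr (~` slice (gls_gsem N al (circ (U N _))) _).
  by apply: funext => v; rewrite setCK.
Qed.

End Translation.

Lemma gls_to_mu (X : eqType) (phi : gls_form A G) :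
  infinite_set [set: X] ->
  exists2 psi : mu_form A G X, mu_closed psi &
    forall N : nbhd_structure A G, gls_mu_equiv N phi psi.
Proof.
move=> Xinf.
pose S := [fset a in gls_traps phi]%fset.
have sS : {subset gls_traps phi <= S} by move=> a; rewrite inE.
have c0 : (finsupp (ctx0 G) `<=` S)%fset by rewrite finsupp0 fsub0set.
have dphi := (gls_slice_definable S).1 phi sS void _ c0.
have [psi psi_closed psiE] := definable_closed Xinf dphi.
by exists psi => // N J; rewrite psiE.
Qed.

End Traps.

(** * From right-linear game logic to the mu-calculus *)

Section RightLinearToMu.
Variables (A : Type) (G : choiceType) (X : eqType).

(** A dualized variable would be read at the complement of the argument, which [rl_definable] cannot
    express; for closed formulas this excludes such variables. *)
Lemma rl_dfv_sub_fv :
  (forall phi : rl_form A G X, {subset rl_dfv phi <= rl_fv phi}) /\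
  (forall al : rl_game A G X, {subset rl_gdfv al <= rl_gfv al}).
Proof.
have sub_cat (s s' t t' : seq X) : {subset s <= s'} -> {subset t <= t'} ->
    {subset s ++ t <= s' ++ t'}.
  by move=> ss tt x; rewrite !mem_cat => /orP[/ss|/tt] ->; rewrite ?orbT.
have sub_filter (s s' : seq X) x : {subset s <= s'} ->
    {subset [seq y <- s | y != x] <= [seq y <- s' | y != x]}.
  by move=> ss y; rewrite !mem_filter => /andP[-> /ss].
apply: rl_mutind => /=; do ?[by []|by move=> ? ? ? ?; apply: sub_cat
  |by move=> ? ? ?; apply: sub_filter].
by move=> x y.
Qed.

Lemma rl_sem_agree (N : nbhd_structure A G) :
  (forall (phi : rl_form A G X) (I I' : X -> monomap (world N)),
    {in rl_fv phi, I =1 I'} -> rl_sem I phi = rl_sem I' phi) /\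
  (forall (al : rl_game A G X) (I I' : X -> monomap (world N)),
    {in rl_gfv al, I =1 I'} -> rl_gsem I al = rl_gsem I' al).
Proof.
have in_cat (s t : seq X) (I I' : X -> monomap (world N)) :
    {in s ++ t, I =1 I'} -> {in s, I =1 I'} /\ {in t, I =1 I'}.
  by move=> H; split=> x xs; apply: H; rewrite mem_cat xs ?orbT.
have in_upd (s : seq X) x u (I I' : X -> monomap (world N)) :
    {in [seq y <- s | y != x], I =1 I'} -> {in s, upd I x u =1 upd I' x u}.
  move=> H y ys; rewrite /upd; case: eqVneq => // yx.
  by apply: H; rewrite mem_filter yx.
apply: rl_mutind => //=.
- by move=> phi IH1 psi IH2 I I' /in_cat[/IH1 -> /IH2 ->].
- by move=> phi IH1 psi IH2 I I' /in_cat[/IH1 -> /IH2 ->].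
- by move=> al IH1 phi IH2 I I' /in_cat[/IH1 -> /IH2 ->].
- by move=> x I I' H; rewrite H // inE.
- by move=> x I I' H; rewrite H // inE.
- by move=> phi IH I I' /IH H; apply: funext => B /=; rewrite H.
- by move=> phi IH I I' /IH H; apply: funext => B /=; rewrite H.
- move=> al IH1 be IH2 I I' /in_cat[/IH1 e1 /IH2 e2].
  by apply: funext => B /=; rewrite e1 e2.
- move=> al IH1 be IH2 I I' /in_cat[/IH1 e1 /IH2 e2].
  by apply: funext => B /=; rewrite e1 e2.
- move=> al IH1 be IH2 I I' /in_cat[/IH1 e1 /IH2 e2].
  by apply: funext => B /=; rewrite e1 e2.
- move=> x al IH I I' H; congr lfp_map.
  by apply: funext => u; apply: IH; apply: in_upd.
- move=> x al IH I I' H; congr gfp_map.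
  by apply: funext => u; apply: IH; apply: in_upd.
Qed.

Lemma filter_nilp (s : seq X) x :
  x \notin s -> nilp [seq y <- s | y != x] -> nilp s.
Proof.
move=> xs; rewrite (_ : [seq y <- s | y != x] = s) //.
by apply/all_filterP/allP => y ys; apply: contraNneq xs => <-.
Qed.

Lemma nilp_cat (s t : seq X) : nilp (s ++ t) -> nilp s /\ nilp t.
Proof. by case: s; case: t. Qed.

(* By right-linearity the value of a game at [B] depends on the values of the
   variables at the same [B] only. *)
Lemma rl_definable :
  (forall phi : rl_form A G X, rl_wf phi -> nilp (rl_fv phi) ->
    nilp (rl_dfv phi) ->
    exists2 F : forall N : nbhd_structure A G, set (world N),
      forall V, @definable A G V (fun N _ => F N) &
      forall N (I : X -> monomap (world N)), rl_sem I phi = F N) /\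
  (forall al : rl_game A G X, rl_gwf al -> nilp (rl_gdfv al) ->
    exists2 F : operator A G (option X), definable F &
      forall N (I : X -> monomap (world N)) B,
        rl_gsem I al B = F N (oapp (fun x => I x B) B)).
Proof.
pose r (x : X) (o : option X) : option (option X) :=
  (* In [option X], [None] is the argument set and [Some x] the value of [x] at it. Under a binder
     of [x], [Some x] becomes the bound variable and everything else is shifted. *)
  if o is Some y then if y == x then None else Some o else Some o.
have rE x W (I : X -> monomap W) (u : monomap W) B :
    oapp (fun y => upd I x u y B) B =
    oapp (oapp (fun y => I y B) B) (u B) \o r x.
  by apply: funext => -[y|] //=; rewrite /upd; case: ifP.
have binder V (F : operator A G V) N (I : X -> monomap (world N))
    (f : V -> option (option X)) : definable F ->
    forall C C' Y Y', C `<=` C' -> Y `<=` Y' ->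
    F N (oapp (oapp (fun y => I y C) C) Y \o f) `<=`
    F N (oapp (oapp (fun y => I y C') C') Y' \o f).
  move=> dF C C' Y Y' CC YY; apply: definable_homo => // v /=.
  by case: (f v) => [[y|]|] //=; apply: mono_homo.
apply: rl_mutind => /=.
- move=> P _ _ _; exists (fun N => val_prop N P) => // V; exact: def_prop.
- move=> P _ _ _; exists (fun N => ~` val_prop N P) => // V; exact: def_nprop.
- move=> phi IH1 psi IH2 /andP[w1 w2] /nilp_cat[f1 f2] /nilp_cat[d1 d2].
  have [F dF FE] := IH1 w1 f1 d1; have [H dH HE] := IH2 w2 f2 d2.
  exists (fun N => F N `|` H N); first by move=> V; apply: def_or.
  by move=> N I; rewrite FE HE.
- move=> phi IH1 psi IH2 /andP[w1 w2] /nilp_cat[f1 f2] /nilp_cat[d1 d2].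
  have [F dF FE] := IH1 w1 f1 d1; have [H dH HE] := IH2 w2 f2 d2.
  exists (fun N => F N `&` H N); first by move=> V; apply: def_and.
  by move=> N I; rewrite FE HE.
- move=> al IH1 phi IH2 /andP[w1 w2] /nilp_cat[f1 f2] /nilp_cat[d1 d2].
  have [F dF FE] := IH1 w1 d1; have [H dH HE] := IH2 w2 f2 d2.
  exists (fun N => F N (fun=> H N)).
    by move=> V; apply: (definable_subst dF).
  move=> N I; rewrite HE.
  (* The game is closed, so its valuation may be replaced by the constant maps with value [H N];
     every variable of [F] then has this value, independently of [I]. *)
  have -> : rl_gsem I al =
      rl_gsem (fun=> MonoMap (fun _ _ _ => @subset_refl _ (H N))) al.
    by apply: (rl_sem_agree N).2 => x; rewrite (nilP f1).
  by rewrite FE /=; congr (F N _); apply: funext => -[].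
- move=> a _ _; exists (fun N J => eff N a (J None)) => //.
  by apply: def_dia; apply: def_var.
- move=> a _ _; exists (fun N J => dual_map (eff N a) (J None)) => //.
  by apply: def_box; apply: def_var.
- move=> x _ _; exists (fun N J => J (Some x)) => //; exact: def_var.
- by [].
- move=> phi IH /andP[w1 f1] d1; have [F dF FE] := IH w1 f1 d1.
  exists (fun N J => F N `&` J None).
    by apply: def_and => //; apply: def_var.
  by move=> N I B /=; rewrite FE.
- move=> phi IH /andP[w1 f1] d1; have [F dF FE] := IH w1 f1 d1.
  exists (fun N J => ~` F N `|` J None).
    by apply: def_or (def_var _ _ _); apply: definable_dual (dF _).
  by move=> N I B /=; rewrite FE.
- move=> al IH1 be IH2 /andP[w1 w2] /nilp_cat[d1 d2].
  have [F dF FE] := IH1 w1 d1; have [H dH HE] := IH2 w2 d2.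
  exists (fun N J => F N J `|` H N J); first exact: def_or.
  by move=> N I B; rewrite FE HE.
- move=> al IH1 be IH2 /andP[w1 w2] /nilp_cat[d1 d2].
  have [F dF FE] := IH1 w1 d1; have [H dH HE] := IH2 w2 d2.
  exists (fun N J => F N J `&` H N J); first exact: def_and.
  by move=> N I B; rewrite FE HE.
- move=> al IH1 be IH2 /and3P[w1 w2 f1] /nilp_cat[d1 d2].
  have [F dF FE] := IH1 w1 d1; have [H dH HE] := IH2 w2 d2.
  exists (fun N J => F N (fun=> H N J)); first exact: (definable_subst dF).
  move=> N I B; rewrite HE; set C := H N _.
  (* Right-linearity enters here: [al] is applied to [C] instead of [B], and a free variable in it
     would have to be known at [C]. *)
  have -> : rl_gsem I al =
      rl_gsem (fun=> MonoMap (fun _ _ _ => @subset_refl _ C)) al.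
    by apply: (rl_sem_agree N).2 => x; rewrite (nilP f1).
  by rewrite FE /=; congr (F N _); apply: funext => -[].
- move=> x al IH /andP[w1 xd] /(filter_nilp xd) d1; have [F dF FE] := IH w1 d1.
  exists (fun N J => lfp (fun Y => F N (oapp J Y \o r x))).
    exact: def_mu (definable_rename dF (r x)).
  move=> N I B; apply: (lfp_map_pointwise (Phi := fun C Y =>
    F N (oapp (oapp (fun y => I y C) C) Y \o r x))); last exact: binder.
  by move=> u C; rewrite FE rE.
- move=> x al IH /andP[w1 xd] /(filter_nilp xd) d1; have [F dF FE] := IH w1 d1.
  exists (fun N J => gfp (fun Y => F N (oapp J Y \o r x))).
    exact: def_nu (definable_rename dF (r x)).
  move=> N I B; apply: (gfp_map_pointwise (Phi := fun C Y =>
    F N (oapp (oapp (fun y => I y C) C) Y \o r x))); last exact: binder.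
  by move=> u C; rewrite FE rE.
Qed.

Lemma rl_to_mu (phi : rl_form A G X) : infinite_set [set: X] ->
  rl_wf phi && rl_closed phi ->
  exists2 psi : mu_form A G X, mu_closed psi &
    forall N : nbhd_structure A G, rl_mu_equiv N phi psi.
Proof.
move=> Xinf /andP[wf cl].
have dcl : nilp (rl_dfv phi).
  have := rl_dfv_sub_fv.1 phi; rewrite (nilP cl).
  by case: rl_dfv => // x s /(_ x); rewrite mem_head => /(_ isT).
have [F dF FE] := rl_definable.1 phi wf cl dcl.
have [psi cpsi psiE] := definable_closed Xinf (dF void).
by exists psi => // N I J; rewrite FE psiE.
Qed.

End RightLinearToMu.

(** * From the mu-calculus to right-linear game logic *)

Section MuHomo.
Variables (A : Type) (G : Type) (X : eqType) (N : nbhd_structure A G).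

(** Comparing valuations on free variables only has the consequence, applied in both directions,
    that a closed formula ignores its valuation. *)
Lemma mu_sem_homo (phi : mu_form A G X) (J J' : X -> set (world N)) :
  {in mu_fv phi, forall x, J x `<=` J' x} -> mu_sem J phi `<=` mu_sem J' phi.
Proof.
have in_upd (s : seq X) x B (I I' : X -> set (world N)) :
    {in [seq y <- s | y != x], forall y, I y `<=` I' y} ->
    {in s, forall y, upd I x B y `<=` upd I' x B y}.
  move=> H y ys; rewrite /upd; case: (eqVneq y x) => [_|yx]; first by [].
  by apply: H; rewrite mem_filter yx.
elim: phi J J' => /=.
- by move=> P J J' _.
- by move=> P J J' _.
- by move=> x J J'; apply; rewrite inE.
- move=> phi IH1 psi IH2 J J' JJ.
  by apply: setUSS; [apply: IH1|apply: IH2] => x xs; apply: JJ;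
    rewrite mem_cat xs ?orbT.
- move=> phi IH1 psi IH2 J J' JJ.
  by apply: setISS; [apply: IH1|apply: IH2] => x xs; apply: JJ;
    rewrite mem_cat xs ?orbT.
- by move=> a phi IH J J' JJ; apply: mono_homo; apply: IH.
- move=> a phi IH J J' JJ; apply: subsetC; apply: mono_homo.
  by apply: subsetC; apply: IH.
- by move=> x phi IH J J' JJ; apply: lfp_homo => B; apply: IH; apply: in_upd.
- by move=> x phi IH J J' JJ; apply: gfp_homo => B; apply: IH; apply: in_upd.
Qed.

End MuHomo.

Section MuToRightLinear.
Variables (A : Type) (G : choiceType) (X : eqType) (P0 : A).

(** Every formula of rlGL ends in a proposition letter; [P0] provides one, even for a formula such
    as [mu x. x] that mentions none. *)
Let rl_top : rl_form A G X := ROr (RProp _ _ P0) (RNProp _ _ P0).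
Let rl_bot : rl_form A G X := RAnd (RProp _ _ P0) (RNProp _ _ P0).

(* A formula becomes a game won by Angel exactly where the formula holds: a play
   that reaches a decided literal ends by Demon failing the test of falsity. *)
Fixpoint game_of_mu (phi : mu_form A G X) : rl_game A G X :=
  match phi with
  | MProp P => RSeq (RTest (RProp _ _ P)) (RDTest rl_bot)
  | MNProp P => RSeq (RTest (RNProp _ _ P)) (RDTest rl_bot)
  | MVar x => RVar _ _ x
  | MOr phi psi => RCup (game_of_mu phi) (game_of_mu psi)
  | MAnd phi psi => RCap (game_of_mu phi) (game_of_mu psi)
  | MDia a phi => RSeq (RAtom _ _ a) (game_of_mu phi)
  | MBox a phi => RSeq (RDAtom _ _ a) (game_of_mu phi)
  | MMu x phi => RMu x (game_of_mu phi)
  | MNu x phi => RNu x (game_of_mu phi)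
  end.

Lemma game_of_mu_fv phi : rl_gfv (game_of_mu phi) = mu_fv phi.
Proof. by elim: phi => //= [phi -> psi ->|phi -> psi ->|x phi ->|x phi ->]. Qed.

Lemma game_of_mu_dfv phi : rl_gdfv (game_of_mu phi) = [::].
Proof. by elim: phi => //= [phi -> psi ->|phi -> psi ->|x phi ->|x phi ->]. Qed.

Lemma game_of_mu_wf phi : rl_gwf (game_of_mu phi).
Proof.
by elim: phi => //= [phi -> psi ->|phi -> psi ->|a phi ->|a phi ->|x phi ->
  |x phi ->] //; rewrite game_of_mu_dfv.
Qed.

(** Variables of the game occur only in tail position and are thus all applied to the original
    argument [B]. *)
Lemma game_of_muE phi (N : nbhd_structure A G) (I : X -> monomap (world N)) B :
  rl_gsem I (game_of_mu phi) B = mu_sem (fun x => I x B) phi.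
Proof.
have updE (I' : X -> monomap (world N)) x u C :
    (fun y => upd I' x u y C) = upd (fun y => I' y C) x (u C).
  by apply: funext => y; rewrite /upd; case: ifP.
have homo phi' x (I' : X -> monomap (world N)) C C' Y Y' :
    C `<=` C' -> Y `<=` Y' -> mu_sem (upd (fun y => I' y C) x Y) phi' `<=`
      mu_sem (upd (fun y => I' y C') x Y') phi'.
  move=> CC YY; apply: mu_sem_homo => y _; rewrite /upd.
  by case: ifP => // _; apply: mono_homo.
elim: phi I B => /=.
- by move=> P I B; rewrite setICr setC0 setTU setIT.
- by move=> P I B; rewrite setICr setC0 setTU setIT.
- by [].
- by move=> phi IH1 psi IH2 I B; rewrite IH1 IH2.
- by move=> phi IH1 psi IH2 I B; rewrite IH1 IH2.
- by move=> a phi IH I B; rewrite IH.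
- by move=> a phi IH I B; rewrite IH.
- move=> x phi IH I B; apply: (lfp_map_pointwise (Phi := fun C Y =>
    mu_sem (upd (fun y => I y C) x Y) phi)); last exact: homo.
  by move=> u C; rewrite IH updE.
- move=> x phi IH I B; apply: (gfp_map_pointwise (Phi := fun C Y =>
    mu_sem (upd (fun y => I y C) x Y) phi)); last exact: homo.
  by move=> u C; rewrite IH updE.
Qed.

Lemma mu_to_rl (psi : mu_form A G X) : mu_closed psi ->
  exists2 phi : rl_form A G X, rl_wf phi && rl_closed phi &
    forall N : nbhd_structure A G, rl_mu_equiv N phi psi.
Proof.
(* The choice of postcondition is immaterial: the game is closed and built so that its value does
   not depend on the set it is applied to. *)
move=> cl; exists (RDia (game_of_mu psi) rl_top).
  by rewrite /rl_closed /= game_of_mu_wf game_of_mu_fv cats0.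
move=> N I J /=; rewrite game_of_muE.
by apply/seteqP; split; apply: mu_sem_homo => x; rewrite (nilP cl).
Qed.

End MuToRightLinear.

(** * From the mu-calculus to sabotage game logic *)

Section DualGames.
Variables (A : Type) (G : choiceType) (N : nbhd_structure A G).
Implicit Types (al be : gls_game A G) (U : set (world N * context G)).
Implicit Types c : context G.

Definition ctx_dtrap (c : context G) (a : G) : context G :=
  [fsfun c with a |-> DemonTrap].

Definition GsDTrap (a : G) : gls_game A G := GsDual (GsTrap _ a).
Definition GsDAtom (a : G) : gls_game A G := GsDual (GsAtom _ a).
Definition GsCap al be := GsDual (GsCup (GsDual al) (GsDual be)).
Definition GsDStar al := GsDual (GsStar (GsDual al)).

Lemma gls_gsem_dtrap a U w c :
  gls_gsem N (GsDTrap a) U (w, c) = U (w, ctx_dtrap c a).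
Proof.
rewrite /= /circ_map /circ /=.
have -> : ctx_swap (ctx_trap (ctx_swap c) a) = ctx_dtrap c a.
  apply/fsfunP => b; rewrite ctx_swapE ctx_trapE fsfun_withE ctx_swapE.
  by case: ifP => //; case: (c b).
by apply: propext; split=> [/contrapT|? []].
Qed.

Lemma gls_gsem_datom_unset a U c : c a = Unset ->
  slice (gls_gsem N (GsDAtom a) U) c = dual_map (eff N a) (slice U c).
Proof.
move=> ca; rewrite /= /circ_map slice_circ; congr (~` _).
have ca' : ctx_swap c a = Unset by rewrite ctx_swapE ca.
have -> : ~` slice U c = slice (circ U) (ctx_swap c).
  by rewrite slice_circ ctx_swapK.
apply/seteqP; split=> w /=; last by left.
by case=> -[]; rewrite ca'.
Qed.

Lemma gls_gsem_datom_demon a U c : c a = DemonTrap ->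
  slice (gls_gsem N (GsDAtom a) U) c = slice U c.
Proof.
move=> ca; rewrite /= /circ_map slice_circ -[RHS]setCK; congr (~` _).
have ca' : ctx_swap c a = AngelTrap by rewrite ctx_swapE ca.
have -> : ~` slice U c = slice (circ U) (ctx_swap c).
  by rewrite slice_circ ctx_swapK.
apply/seteqP; split=> w /=; last by right.
by case=> -[]; rewrite ca'.
Qed.

Lemma gls_gsem_datom_angel a U c : c a = AngelTrap ->
  slice (gls_gsem N (GsDAtom a) U) c = setT.
Proof.
move=> ca; rewrite /= /circ_map slice_circ -setC0; congr (~` _).
have ca' : ctx_swap c a = DemonTrap by rewrite ctx_swapE ca.
by apply/seteqP; split=> w //=; case=> -[]; rewrite ca'.
Qed.

Lemma gls_gsem_atom_unset a U c : c a = Unset ->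
  slice (gls_gsem N (GsAtom A a) U) c = eff N a (slice U c).
Proof.
move=> ca; apply/seteqP; split=> w /=; last by left.
by case=> -[] /=; rewrite ca.
Qed.

Lemma gls_gsem_atom_angel a U c : c a = AngelTrap ->
  slice (gls_gsem N (GsAtom A a) U) c = slice U c.
Proof.
move=> ca; apply/seteqP; split=> w /=; last by right.
by case=> -[] /=; rewrite ca.
Qed.

Lemma gls_gsem_atom_demon a U c : c a = DemonTrap ->
  slice (gls_gsem N (GsAtom A a) U) c = set0.
Proof.
by move=> ca; apply/seteqP; split=> w //=; case=> -[] /=; rewrite ca.
Qed.

Lemma gls_gsem_cap al be U :
  gls_gsem N (GsCap al be) U = gls_gsem N al U `&` gls_gsem N be U.
Proof.
rewrite /= /circ_map circK.
apply/seteqP; split=> -[w c]; rewrite /circ /= ctx_swapK.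
  by move=> H; split; apply: contrapT => H'; apply: H; [left|right].
by case=> H1 H2 [].
Qed.

Lemma gls_gsem_dstar al U :
  gls_gsem N (GsDStar al) U = gfp (fun B => U `&` gls_gsem N al B).
Proof.
rewrite /= /circ_map; apply/seteqP; split=> -[w c].
  move=> H; exists (circ (lfp (fun B => circ U `|`
    circ (gls_gsem N al (circ B))))) => //= {w c H}.
  set L := lfp _ => p.
  have LE : circ U `|` circ (gls_gsem N al (circ L)) = L.
    apply: lfp_fix => B C BC; apply: setUS; apply: circ_homo.
    by apply: gls_gsem_homo; apply: circ_homo.
  rewrite -{1}LE {1}/circ; case: p => [w c] /= H.
  split; apply: contrapT => H'; apply: H; [left|right];
    by rewrite /circ /= ctx_swapK.
case=> B BU Bw H; have : circ B (w, ctx_swap c).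
  apply: H => -[v d] /= [|].
    by move=> + /BU[H _]; apply.
  by rewrite circK => + /BU[_ H]; apply.
by rewrite /circ /= ctx_swapK.
Qed.

End DualGames.

(** * Fixpoint variables encoded as flags *)

Section FlagTranslation.
Variables (A : Type) (G : choiceType) (X : eqType) (P0 : A).

Fixpoint mu_vars (phi : mu_form A G X) : seq X :=
  match phi with
  | MProp _ | MNProp _ => [::]
  | MVar x => [:: x]
  | MOr phi psi | MAnd phi psi => mu_vars phi ++ mu_vars psi
  | MDia _ phi | MBox _ phi => mu_vars phi
  | MMu x phi | MNu x phi => x :: mu_vars phi
  end.

Fixpoint mu_atoms (phi : mu_form A G X) : seq G :=
  match phi with
  | MProp _ | MNProp _ | MVar _ => [::]
  | MOr phi psi | MAnd phi psi => mu_atoms phi ++ mu_atoms psi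
  | MDia a phi | MBox a phi => a :: mu_atoms phi
  | MMu _ phi | MNu _ phi => mu_atoms phi
  end.

Lemma mu_fv_vars phi : {subset mu_fv phi <= mu_vars phi}.
Proof.
elim: phi => /=; do ?by [].
- by move=> x y.
- by move=> phi IH1 psi IH2 x; rewrite !mem_cat => /orP[/IH1|/IH2] ->;
    rewrite ?orbT.
- by move=> phi IH1 psi IH2 x; rewrite !mem_cat => /orP[/IH1|/IH2] ->;
    rewrite ?orbT.
- by move=> x phi IH y; rewrite mem_filter inE => /andP[_ /IH ->]; rewrite orbT.
- by move=> x phi IH y; rewrite mem_filter inE => /andP[_ /IH ->]; rewrite orbT.
Qed.

(* The flag of the variable [x] is the pair of atoms [p x], [n x]: it is up in a
   context if they are marked A and D, and down if they are marked D and A. Two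
   atoms are needed because Angel cannot test for the mark D, nor Demon for the
   mark A. *)
Variables (p n : X -> G) (vs : seq X).
Hypothesis p_inj : {in vs &, injective p}.
Hypothesis n_inj : {in vs &, injective n}.
Hypothesis pn : forall x y, p x != n y.

Local Notation game := (gls_game A G).

Definition gls_top : gls_form A G := GsOr (GsProp _ P0) (GsNeg (GsProp _ P0)).
Definition gls_bot : gls_form A G := GsNeg gls_top.

Definition flag_up x : game := GsSeq (GsTrap _ (p x)) (GsDTrap _ (n x)).
Definition flag_down x : game := GsSeq (GsDTrap _ (p x)) (GsTrap _ (n x)).
(** Demon faces a test that he cannot pass, so Angel wins whatever follows. *)
Definition gls_win : game := GsDual (GsTest gls_bot).

(* A variable raises its flag and ends the game; the loop of its binder takes
   over exactly when the flag is up, and every other flag leaves the loop. *)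
Fixpoint gls_of_mu (phi : mu_form A G X) : game :=
  match phi with
  | MProp P => GsSeq (GsTest (GsProp _ P)) gls_win
  | MNProp P => GsSeq (GsTest (GsNeg (GsProp _ P))) gls_win
  | MVar x => flag_up x
  | MOr phi psi => GsCup (gls_of_mu phi) (gls_of_mu psi)
  | MAnd phi psi => GsCap (gls_of_mu phi) (gls_of_mu psi)
  | MDia a phi => GsSeq (GsAtom _ a) (gls_of_mu phi)
  | MBox a phi => GsSeq (GsDAtom _ a) (gls_of_mu phi)
  | MMu x phi => GsSeq (flag_up x)
      (GsSeq (GsStar (GsSeq (GsAtom _ (p x))
                            (GsSeq (flag_down x) (gls_of_mu phi))))
             (GsAtom _ (n x)))
  | MNu x phi => GsSeq (flag_up x)
      (GsSeq (GsDStar (GsSeq (GsDAtom _ (n x))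
                             (GsSeq (flag_down x) (gls_of_mu phi))))
             (GsDAtom _ (p x)))
  end.

Definition ctx_down (c : context G) x := ctx_trap (ctx_dtrap c (p x)) (n x).
Definition ctx_up (c : context G) x := ctx_dtrap (ctx_trap c (p x)) (n x).

Definition ctx_base := foldr (fun x c => ctx_down c x) (ctx0 G) vs.

(** In [c0] the flag atoms are unmarked and would act through the structure, so all flags are
    lowered before the play. The left nesting treats the head of [vs] last, in agreement with
    [ctx_base]. *)
Definition gls_init : game :=
  foldr (fun x al => GsSeq al (flag_down x)) (GsTest gls_top) vs.

Local Notation b := ctx_base.
Local Notation bx := (ctx_up b).

Lemma ctx_base_flag x : x \in vs -> b (p x) = DemonTrap /\ b (n x) = AngelTrap.
Proof.
rewrite /ctx_base; elim: vs => //= y r IH; rewrite inE /ctx_down.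
rewrite !(ctx_trapE, fsfun_withE) (negPf (pn x y)) [n x == p y]eq_sym.
rewrite (negPf (pn y x)).
by case: (eqVneq x y) => [->|_ /IH[-> ->]]; rewrite ?eqxx //; do 2?case: ifP.
Qed.

Lemma ctx_base_unset a : (forall x, a != p x) -> (forall x, a != n x) ->
  b a = Unset.
Proof.
move=> ap an; rewrite /ctx_base; elim: vs => [|y r IH] /=.
  by rewrite /ctx0 fsfun0E.
by rewrite /ctx_down ctx_trapE fsfun_withE (negPf (ap y)) (negPf (an y)).
Qed.

Lemma ctx_up_p x y : x \in vs -> y \in vs ->
  bx y (p x) = if x == y then AngelTrap else DemonTrap.
Proof.
move=> xv yv; rewrite /ctx_up fsfun_withE ctx_trapE (negPf (pn x y)).
by rewrite (inj_in_eq p_inj) // (ctx_base_flag xv).1.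
Qed.

Lemma ctx_up_n x y : x \in vs -> y \in vs ->
  bx y (n x) = if x == y then DemonTrap else AngelTrap.
Proof.
move=> xv yv; rewrite /ctx_up fsfun_withE ctx_trapE [n x == p y]eq_sym.
rewrite (negPf (pn y x)).
by rewrite (inj_in_eq n_inj) // (ctx_base_flag xv).2.
Qed.

(** Every round of a loop starts from the base context again, where the induction hypothesis on the
    body applies. *)
Lemma ctx_upK x : x \in vs -> ctx_down (bx x) x = b.
Proof.
move=> xv; apply/fsfunP => a.
rewrite /ctx_down /ctx_up !(ctx_trapE, fsfun_withE).
have [b1 b2] := ctx_base_flag xv.
case: (eqVneq a (n x)) => [->|_]; first by rewrite b2.
by case: (eqVneq a (p x)) => [->|_].
Qed.

Variable N : nbhd_structure A G.
Implicit Types U : set (world N * context G).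

Lemma slice_flag_up x U c :
  slice (gls_gsem N (flag_up x) U) c = slice U (ctx_up c x).
Proof. by apply: funext => w; rewrite /slice /= -gls_gsem_dtrap. Qed.

Lemma slice_flag_down x U c :
  slice (gls_gsem N (flag_down x) U) c = slice U (ctx_down c x).
Proof. by apply: funext => w; rewrite /slice /mkset [LHS]gls_gsem_dtrap. Qed.

Lemma gls_bot_sem : gls_sem N gls_bot = set0.
Proof.
apply/seteqP; split=> -[w c] //=; rewrite /circ /=; apply.
exact: EM.
Qed.

Lemma gls_gsem_win U : gls_gsem N gls_win U = setT.
Proof.
apply/seteqP; split=> // q _.
rewrite -[gls_gsem _ _ _]/(circ (gls_sem N gls_bot `&` circ U)).
by rewrite gls_bot_sem set0I.
Qed.

Lemma slice_init U : slice (gls_gsem N gls_init U) (ctx0 G) = slice U b.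
Proof.
rewrite /gls_init /ctx_base; elim: vs U => [|x r IH] U /=.
  apply/seteqP; split=> w /=; first by case.
  by split=> //; apply: EM.
by rewrite -slice_flag_down -IH.
Qed.

Section FixpointSlice.
Variables (phi : mu_form A G X) (x : X) (U : set (world N * context G)).
Variable Phi : set (world N * context G) -> set (world N * context G).
Hypothesis xv : x \in vs.
Hypothesis phi_vs : {subset mu_fv phi <= vs}.
Hypothesis Phi_homo : forall B C, B `<=` C -> Phi B `<=` Phi C.
Hypothesis Phi_x : forall B,
  slice (Phi B) (bx x) = mu_sem (fun y => slice B (bx y)) phi.
Hypothesis Phi_exit : forall B y, y \in vs -> y != x ->
  slice (Phi B) (bx y) = slice U (bx y).

Let J y := slice U (bx y).

(** At the flag of any other variable of [vs] a fixpoint of [Phi] agrees with [U], so only its slice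
    at the flag of [x] is unknown, and that slice solves the equation in one variable. *)
Let mu_sem_fix L : Phi L = L ->
  slice L (bx x) = mu_sem (upd J x (slice L (bx x))) phi.
Proof.
move=> LE; rewrite -{1}LE Phi_x.
by apply/seteqP; split; apply: mu_sem_homo => y /phi_vs yv; rewrite /upd;
  case: (eqVneq y x) => [-> //|yx]; rewrite /J -(Phi_exit L) // LE.
Qed.

Lemma slice_lfp :
  slice (lfp Phi) (bx x) = lfp (fun Y => mu_sem (upd J x Y) phi).
Proof.
set R := RHS; have RE : mu_sem (upd J x R) phi = R.
  apply: lfp_fix => B C BC; apply: mu_sem_homo => y _; rewrite /upd.
  by case: ifP => _; [apply: BC|apply: subset_refl].
apply/seteqP; split; last first.
  by apply: lfp_least; rewrite -mu_sem_fix //; apply: lfp_fix.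
(* The set [Z] is constrained only where a single flag is up, by [R] for [x] and by [J] for the
   others; it is full elsewhere, so the prefixpoint condition is trivial there. *)
pose Z : set (world N * context G) :=
  [set q | forall y, y \in vs -> q.2 = bx y -> upd J x R y q.1].
have ZR y : y \in vs -> slice Z (bx y) `<=` upd J x R y.
  by move=> yv w; apply.
have LZ : lfp Phi `<=` Z.
  apply: lfp_least => -[w c] Phiw y yv /= cE; rewrite {}cE in Phiw.
  change (slice (Phi Z) (bx y) w) in Phiw; rewrite /upd.
  case: (eqVneq y x) Phiw => [->|yx]; last by rewrite Phi_exit.
  by rewrite Phi_x -RE; apply: mu_sem_homo => z /phi_vs; apply: ZR.
by move=> w /LZ /(_ x xv erefl); rewrite /upd eqxx.
Qed.

Lemma slice_gfp :
  slice (gfp Phi) (bx x) = gfp (fun Y => mu_sem (upd J x Y) phi).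
Proof.
set R := RHS; have RE : mu_sem (upd J x R) phi = R.
  apply: gfp_fix => B C BC; apply: mu_sem_homo => y _; rewrite /upd.
  by case: ifP => _; [apply: BC|apply: subset_refl].
apply/seteqP; split.
  by apply: gfp_greatest; rewrite -mu_sem_fix //; apply: gfp_fix.
(* Dually, [Z] is empty away from the contexts with one flag up. *)
pose Z : set (world N * context G) :=
  [set q | exists2 y, y \in vs /\ q.2 = bx y & upd J x R y q.1].
have RZ y : y \in vs -> upd J x R y `<=` slice Z (bx y).
  by move=> yv w Rw; exists y.
have ZL : Z `<=` gfp Phi.
  apply: gfp_greatest => -[w c] [y [yv /= ->]] Rw; rewrite /upd in Rw.
  change (slice (Phi Z) (bx y) w).
  case: (eqVneq y x) Rw => [->|yx]; last by rewrite Phi_exit.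
  by rewrite Phi_x -{1}RE; apply: mu_sem_homo => z /phi_vs; apply: RZ.
by move=> w Rw; apply: ZL; exists x => //; rewrite /upd eqxx.
Qed.

End FixpointSlice.

(** The generality in [U] is used at fixpoints, where the body is played towards the current
    approximation of the loop. *)
Lemma gls_of_muE phi U : {subset mu_vars phi <= vs} ->
  {in mu_atoms phi, forall a, b a = Unset} ->
  slice (gls_gsem N (gls_of_mu phi) U) b =
  mu_sem (fun y => slice U (bx y)) phi.
Proof.
elim: phi U.
- move=> P U _ _.
  rewrite -[gls_gsem _ _ _]/(gls_sem N (GsProp G P) `&` gls_gsem N gls_win U).
  by rewrite gls_gsem_win setIT.
- move=> P U _ _.
  rewrite -[gls_gsem _ _ _]/(gls_sem N (GsNeg (GsProp G P)) `&`
    gls_gsem N gls_win U).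
  by rewrite gls_gsem_win setIT.
- by move=> x U _ _; rewrite slice_flag_up.
- move=> phi IH1 psi IH2 U /subset_cat[v1 v2] at12.
  rewrite /= -IH1 -?IH2 // => a aa; apply: at12; rewrite /= mem_cat aa ?orbT //.
- move=> phi IH1 psi IH2 U /subset_cat[v1 v2] at12.
  rewrite [gls_of_mu _]/= gls_gsem_cap /= -IH1 -?IH2 // => a aa; apply: at12;
    rewrite /= mem_cat aa ?orbT //.
- move=> a phi IH U vP aP; rewrite [mu_sem _ _]/= -IH //; last first.
    by move=> c cP; apply: aP; rewrite inE cP orbT.
  by rewrite -gls_gsem_atom_unset //; apply: aP; apply: mem_head.
- move=> a phi IH U vP aP; rewrite [mu_sem _ _]/= -IH //; last first.
    by move=> c cP; apply: aP; rewrite inE cP orbT.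
  by rewrite -gls_gsem_datom_unset //; apply: aP; apply: mem_head.
- move=> x phi IH U vP aP; rewrite [gls_of_mu _]/=.
  have xv : x \in vs by apply: vP; apply: mem_head.
  have {}vP : {subset mu_vars phi <= vs}.
    by move=> y yv; apply: vP; rewrite inE yv orbT.
  set body := GsSeq (GsAtom _ (p x)) _.
  have -> V : slice (gls_gsem N (GsSeq (flag_up x) V) U) b =
     slice (gls_gsem N V U) (bx x) by rewrite -slice_flag_up.
  apply: (@slice_lfp phi x U (fun B => gls_gsem N (GsAtom _ (n x)) U `|`
    gls_gsem N body B)) => //.
  + by move=> y /mu_fv_vars /vP.
  + by move=> B C BC; apply: setUS; apply: gls_gsem_homo.
  (* With the flag of [x] up, [n x] is marked D and leaving loses, while [p x] is marked A and lets
     Angel replay the body. *)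
  + move=> B; rewrite -IH // -[LHS]/(slice _ _ `|` slice _ _).
    rewrite gls_gsem_atom_demon ?ctx_up_n ?eqxx // set0U.
    rewrite -[gls_gsem _ _ _]/(gls_gsem N (GsAtom _ (p x)) _).
    by rewrite gls_gsem_atom_angel ?ctx_up_p ?eqxx // slice_flag_down ctx_upK.
  (* With another flag up, the marks of [p x] and [n x] are exchanged, so replaying loses and
     leaving succeeds. *)
  + move=> B y yv yx; rewrite -[LHS]/(slice _ _ `|` slice _ _).
    rewrite gls_gsem_atom_angel ?ctx_up_n // 1?eq_sym ?(negPf yx) //.
    rewrite -[gls_gsem _ body _]/(gls_gsem N (GsAtom _ (p x)) _).
    by rewrite gls_gsem_atom_demon ?setU0 // ctx_up_p // eq_sym (negPf yx).
- move=> x phi IH U vP aP; rewrite [gls_of_mu _]/=.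
  have xv : x \in vs by apply: vP; apply: mem_head.
  have {}vP : {subset mu_vars phi <= vs}.
    by move=> y yv; apply: vP; rewrite inE yv orbT.
  set body := GsSeq (GsDAtom _ (n x)) _.
  have -> V : slice (gls_gsem N (GsSeq (flag_up x) V) U) b =
     slice (gls_gsem N V U) (bx x) by rewrite -slice_flag_up.
  rewrite -[gls_gsem _ _ _]/(gls_gsem N (GsDStar body) _) gls_gsem_dstar.
  apply: (@slice_gfp phi x U) => //.
  + by move=> y /mu_fv_vars /vP.
  + by move=> B C BC; apply: setIS; apply: gls_gsem_homo.
  (* The loop is now Demon's: a dual atom lets the play pass at D and makes Angel win at A, hence
     [n x] guards the body and [p x] the exit. *)
  + move=> B; rewrite -IH // -[LHS]/(slice _ _ `&` slice _ _).
    rewrite gls_gsem_datom_angel ?ctx_up_p ?eqxx // setTI.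
    rewrite -[gls_gsem _ _ _]/(gls_gsem N (GsDAtom _ (n x)) _).
    by rewrite gls_gsem_datom_demon ?ctx_up_n ?eqxx // slice_flag_down ctx_upK.
  + move=> B y yv yx; rewrite -[LHS]/(slice _ _ `&` slice _ _).
    rewrite gls_gsem_datom_demon ?ctx_up_p // 1?eq_sym ?(negPf yx) //.
    rewrite -[gls_gsem _ body _]/(gls_gsem N (GsDAtom _ (n x)) _).
    by rewrite gls_gsem_datom_angel ?setIT // ctx_up_n // eq_sym (negPf yx).
Qed.

End FlagTranslation.

Lemma mu_to_gls (A : Type) (G : choiceType) (X : eqType) (P0 : A)
    (psi : mu_form A G X) :
  infinite_set [set: G] -> mu_closed psi ->
  exists phi : gls_form A G,
    forall N : nbhd_structure A G, gls_mu_equiv N phi psi.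
Proof.
move=> Ginf cl.
have /infinite_set_inj[h hI hP] :=
  infinite_setD Ginf (finite_seq (mu_atoms psi)).
pose vs := mu_vars psi.
(* Even and odd indices separate the two atoms of the flags, and [h] avoids the atoms of [psi],
   which must stay unmarked to keep their effect. *)
pose p x := h (index x vs).*2; pose n x := h (index x vs).*2.+1.
have p_inj : {in vs &, injective p}.
  by move=> x y xv yv /hI/double_inj; apply: index_inj.
have n_inj : {in vs &, injective n}.
  by move=> x y xv yv /hI/succn_inj/double_inj; apply: index_inj.
have pn x y : p x != n y.
  by apply/eqP => /hI/(congr1 odd); rewrite /= !odd_double.
exists (GsDia (GsSeq (gls_init P0 p n vs) (gls_of_mu P0 p n psi))
  (gls_bot G P0)) => N J.
rewrite -[LHS]/(slice (gls_gsem N (gls_init P0 p n vs) _) _) slice_init.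
rewrite (gls_of_muE P0 p_inj n_inj) //; last first.
  move=> a aP; apply: ctx_base_unset => x; apply: contraPneq aP => ->.
    by have [_] := hP (index x vs).*2.
  by have [_] := hP (index x vs).*2.+1.
by apply/seteqP; split; apply: mu_sem_homo => x; rewrite (nilP cl).
Qed.

Theorem theorem7p5 (A : Type) (G : choiceType) (X : eqType)
    (A_nonempty : [set: A] !=set0)
    (G_infinite : infinite_set [set: G])
    (X_infinite : infinite_set [set: X]) :
  [/\ forall phi : gls_form A G,
        exists2 psi : rl_form A G X, rl_wf psi && rl_closed psi &
          forall N : nbhd_structure A G, gls_rl_equiv N phi psi,
      forall psi : rl_form A G X, rl_wf psi && rl_closed psi ->
        exists phi : gls_form A G,
          forall N : nbhd_structure A G, gls_rl_equiv N phi psi &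
      [/\ forall phi : gls_form A G,
            exists2 psi : mu_form A G X, mu_closed psi &
              forall N : nbhd_structure A G, gls_mu_equiv N phi psi,
          forall psi : mu_form A G X, mu_closed psi ->
            exists phi : gls_form A G,
              forall N : nbhd_structure A G, gls_mu_equiv N phi psi,
          forall phi : rl_form A G X, rl_wf phi && rl_closed phi ->
            exists2 psi : mu_form A G X, mu_closed psi &
              forall N : nbhd_structure A G, rl_mu_equiv N phi psi &
          forall psi : mu_form A G X, mu_closed psi ->
            exists2 phi : rl_form A G X, rl_wf phi && rl_closed phi &
              forall N : nbhd_structure A G, rl_mu_equiv N phi psi]].
Proof.
have [P0 _] := A_nonempty; split; [| |split].
- move=> phi; have [psi cpsi psiE] := gls_to_mu phi X_infinite.
  have [chi wchi chiE] := mu_to_rl P0 cpsi.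
  (* The intermediate formula is compared under every valuation; [set0] is an arbitrary choice. *)
  by exists chi => // N I; rewrite (chiE N I (fun _ => set0)); apply: psiE.
- move=> chi wchi; have [psi cpsi psiE] := rl_to_mu X_infinite wchi.
  have [phi phiE] := mu_to_gls P0 G_infinite cpsi.
  by exists phi => N I; rewrite (psiE N I (fun _ => set0)); apply: phiE.
- by move=> phi; apply: gls_to_mu.
- by move=> psi; apply: mu_to_gls.
- by move=> phi; apply: rl_to_mu.
- by move=> psi; apply: mu_to_rl.
Qed.
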